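(* Let $\mathcal{U}=\{u_1,\dots,u_m\}$, $\mathcal{W}=\{w_1,\dots,w_{m'}\}\subset\mathbb{R}^d$ be the step sets and $p\in(0,1)$ the memory parameter. Let $p_c^m=\frac{m+1}{2m}$, $p_c^{m'}=\frac{m'+1}{2m'}$, $a=\frac{mp-1}{m-1}$, $\bar u=\frac1m\sum_{i=1}^m u_i$, $\bar w=\frac1{m'}\sum_{j=1}^{m'}w_j$, and suppose $0<p_c^m=p_c^{m'}<p$. Then the following almost sure functional convergences (almost sure convergence in the Skorokhod space $D([0,\infty))$) hold. (i) For the Type-II elephant random walk $\{S_n\}_{n=0}^\infty$, almost surely $$\left\{\frac{S_{\lfloor 2nt\rfloor}-nt(\bar u+\bar w)}{n^a}\right\}_{t\ge0}\to\{t^aL\}_{t\ge0}\quad\text{as } n\to\infty,$$ where $L$ is some $\mathbb{R}^d$-valued random variable different from zero (i.e. not almost surely equal to $\mathbf{0}$). (ii) For the Type-I elephant random walk $\{S_n\}_{n=0}^\infty$, almost surely $$\left\{\frac{S_{\lfloor nt\rfloor}-nt\bar u}{n^a}\right\}_{t\ge0}\to\{t^a\tilde L\}_{t\ge0}\quad\text{as } n\to\infty,$$ where $\tilde L$ is some $\mathbb{R}^d$-valued random variable different from zero (i.e. not almost surely equal to $\mathbf{0}$).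
   Context: Step sets. Fix $d\ge1$, integers $m,m'\ge2$, and finite sets of distinct vectors $\mathcal{U}=\{u_1,\dots,u_m\}\subset\mathbb{R}^d$, $\mathcal{W}=\{w_1,\dots,w_{m'}\}\subset\mathbb{R}^d$. A lattice in $\mathbb{R}^d$ is a discrete additive subgroup spanning $\mathbb{R}^d$ over $\mathbb{R}$. Standing assumptions: - If $\mathcal{U}=\mathcal{W}$ (so $m=m'$): the semigroup $\Gamma=\{\sum_{i=1}^m k_iu_i: k_i\in\mathbb{N}\cup\{0\}\}$ is a lattice in $\mathbb{R}^d$. - If $\mathcal{U}\ne\mathcal{W}$: the semigroup $\Gamma_0=\{\sum_{i=1}^m k_iu_i+\sum_{j=1}^{m'}l_jw_j:\ \sum_i k_i=\sum_j l_j,\ k_i,l_j\in\mathbb{N}\cup\{0\}\}$ is a lattice in $\mathbb{R}^d$, and the sets $\Gamma_0$ and $\Gamma_0+\mathcal{U}$ are disjoint. The state space is $\Gamma=\Gamma_0\sqcup(\Gamma_0+\mathcal{U})$; adding an element of $\mathcal{U}$ to a point of $\Gamma_0$ gives a point of $\Gamma_0+\mathcal{U}$, and adding an element of $\mathcal{W}$ to a point of $\Gamma_0+\mathcal{U}$ gives a point of $\Gamma_0$. Step processes. Let $p\in(0,1)$ (the memory parameter) and fix $1\le i_0\le m$, $1\le j_0\le m'$. The $\mathcal{U}$-valued sequence $\{\sigma_i\}_{i\ge1}$ is defined by $\sigma_1=u_{i_0}$ and, for each $n\ge1$: given $\sigma_1,\dots,\sigma_n$, let $U_n$ be uniform on $\{1,\dots,n\}$,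 independent of $\sigma_1,\dots,\sigma_n$; then $\sigma_{n+1}=\sigma_{U_n}$ with probability $p$, and $\sigma_{n+1}=\sigma$ with probability $\frac{1-p}{m-1}$ for each $\sigma\in\mathcal{U}\setminus\{\sigma_{U_n}\}$. The $\mathcal{W}$-valued sequence $\{\tau_j\}_{j\ge1}$ is defined in the same way, with $\tau_1=w_{j_0}$, $m'$ in place of $m$, $\mathcal{W}$ in place of $\mathcal{U}$, and an auxiliary uniform variable on $\{1,\dots,n\}$ of its own in place of $U_n$. The two sequences (with their auxiliary variables) are independent of each other. Type-II ERW (case $\mathcal{U}\neq\mathcal{W}$): $S_0=\mathbf{0}$, $S_{2n}=\sum_{i=1}^n(\sigma_i+\tau_i)$ and $S_{2n-1}=S_{2(n-1)}+\sigma_n$ for $n\ge1$. Type-I ERW (case $\mathcal{U}=\mathcal{W}$): $S_0=\mathbf{0}$ and $S_n=\sum_{i=1}^n\sigma_i$ for $n\ge1$. (In this case $m=m'$, so $p_c^m=p_c^{m'}$ automatically.) $D([0,\infty))$ is the Skorokhod space of right-continuous functions with left-hand limits (here $\mathbb{R}^d$-valued). *)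

(* Defs.v *)
From HB Require Import structures.
From mathcomp Require Export all_boot all_order all_algebra.
From mathcomp Require Export all_classical all_reals all_analysis.
Export Order.TTheory GRing.Theory Num.Theory numFieldNormedType.Exports.

Set Implicit Arguments.
Unset Strict Implicit.
Unset Printing Implicit Defensive.

Local Open Scope classical_set_scope.
Local Open Scope ring_scope.

Section Lattices.
Context {R : realType} {d : nat}.
Implicit Types G : set 'rV[R]_d.

Definition is_lattice G : Prop :=
  [/\ G 0,
      forall x y, G x -> G y -> G (x - y),
      forall x, G x -> \forall y \near x, G y -> y = x
    & exists X : seq 'rV[R]_d,
        (forall x, x \in X -> G x) /\ (<<X>> = fullv)%VS].

Definition semigroup_I {m : nat} (u : 'I_m -> 'rV[R]_d) : set 'rV[R]_d :=
  [set x | exists k : 'I_m -> nat, x = \sum_(i < m) u i *+ k i].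

Definition semigroup_II {m m' : nat}
    (u : 'I_m -> 'rV[R]_d) (w : 'I_m' -> 'rV[R]_d) : set 'rV[R]_d :=
  [set x | exists (k : 'I_m -> nat) (l : 'I_m' -> nat),
     (\sum_(i < m) k i = \sum_(j < m') l j)%N /\
     x = \sum_(i < m) u i *+ k i + \sum_(j < m') w j *+ l j].

Definition set_translates G (A : set 'rV[R]_d) : set 'rV[R]_d :=
  [set x | exists y z, [/\ G y, A z & x = y + z]].

Definition vmean {m : nat} (u : 'I_m -> 'rV[R]_d) : 'rV[R]_d :=
  m%:R^-1 *: \sum_(i < m) u i.

End Lattices.

Definition critical_p (R : realType) (m : nat) : R :=
  (m%:R + 1) / (2 * m%:R).

Section StepProcesses.
Context {R : realType} {d : nat} {dO : measure_display}.
Context {Omega : measurableType dO} (P : probability Omega R).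

(* Sequences are indexed from 0: [s n] is the (n+1)-st step, and the auxiliary
   variable [U n], valued in {0, ..., n}, selects one of the n+1 steps
   [s 0], ..., [s n] when [s n.+1] is drawn. *)
Implicit Types (s t : nat -> Omega -> 'rV[R]_d)
  (U V : forall n : nat, Omega -> 'I_n.+1).

Definition past s {m : nat} (v : 'I_m -> 'rV[R]_d) (n : nat)
    (h : 'I_n.+1 -> 'I_m) : set Omega :=
  [set x | forall k : 'I_n.+1, s k x = v (h k)].

(* Every conditioning variable is finitely valued, so the conditional law of
   [s n.+1] given the past and [U n] is written in product form, which also
   makes sense when the conditioning event is null. *)
Definition step_process (m : nat) (v : 'I_m -> 'rV[R]_d) (p : R) (i0 : 'I_m)
    s U : Prop :=
  [/\ [/\ forall n x, range v (s n x),
          forall n i, measurable (s n @^-1` [set v i])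
        & forall n k, measurable (U n @^-1` [set k])],
      forall x, s 0 x = v i0,
      forall n k, P (U n @^-1` [set k]) = (n.+1%:R^-1)%:E,
      forall n (h : 'I_n.+1 -> 'I_m) k,
        P (past s v h `&` U n @^-1` [set k]) =
        (P (past s v h) * P (U n @^-1` [set k]))%E
    & forall n (h : 'I_n.+1 -> 'I_m) k i,
        P (past s v h `&` U n @^-1` [set k] `&` s n.+1 @^-1` [set v i]) =
        (P (past s v h `&` U n @^-1` [set k]) *
         (if i == h k then p else (1 - p) / (m%:R - 1))%:E)%E].

Definition process_sigma_algebra s U : set (set Omega) :=
  <<s [set A | (exists n v, A = s n @^-1` [set v]) \/
               (exists n k, A = U n @^-1` [set k])] >>.

Definition independent_processes s U t V : Prop :=
  forall A B, process_sigma_algebra s U A -> process_sigma_algebra t V B ->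
    P (A `&` B) = (P A * P B)%E.

Definition walk_I s (n : nat) (x : Omega) : 'rV[R]_d := \sum_(i < n) s i x.

Definition walk_II s t (n : nat) (x : Omega) : 'rV[R]_d :=
  \sum_(i < n./2) (s i x + t i x) + (if odd n then s n./2 x else 0).

Definition random_vector (L : Omega -> 'rV[R]_d) : Prop :=
  forall O : set 'rV[R]_d, open O -> measurable (L @^-1` O).

End StepProcesses.

Section Skorokhod.
Context {R : realType} {d : nat}.

(* Paths on [0, oo) are functions on R whose values on negative arguments are
   never used. *)
Definition cadlag (f : R -> 'rV[R]_d) : Prop :=
  (forall t : R, 0 <= t -> f x @[x --> t^'+] --> f t) /\
  (forall t : R, 0 < t -> cvg (f x @[x --> t^'-])).

Definition time_change (lam : R -> R) : Prop :=
  [/\ lam 0 = 0,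
      {in `[0, +oo[ &, {homo lam : x y / x < y}},
      {within `[0, +oo[, continuous lam}
    & lam @` `[0, +oo[%classic = `[0, +oo[%classic].

(* Convergence of sequences in the J1 topology of D([0, oo)), as in Jacod and
   Shiryaev, Limit Theorems for Stochastic Processes, VI.1.14. *)
Definition skorokhod_cvg (f_ : nat -> R -> 'rV[R]_d) (f : R -> 'rV[R]_d)
    : Prop :=
  [/\ forall n, cadlag (f_ n),
      cadlag f
    & exists lam : nat -> R -> R,
        [/\ forall n, time_change (lam n),
            {uniform `[0, +oo[, lam @ \oo --> (id : R -> R)}
          & forall T : R, 0 <= T ->
              {uniform `[0, T], (fun n => f_ n \o lam n) @ \oo --> f}]].

End Skorokhod.

(* Main.v *)
Require Import Defs.
From mathcomp Require Import ring lra zify.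

Set Implicit Arguments.
Unset Strict Implicit.
Unset Printing Implicit Defensive.

Local Open Scope classical_set_scope.
Local Open Scope ring_scope.

(** Given the first n steps, the next one is v_i with probability
    a N_i / n + (1 - p) / (m - 1), where N_i counts the steps equal to v_i so
    far. Centred, this is a linear reinforcement: for g with sum_i g(i) = 0 and
    F_n = g(step 1) + ... + g(step n), the conditional mean of F_{n+1} is
    (1 + a / n) F_n. So F_n divided by the product of the 1 + a / k for k < n
    is a martingale ([erw_mart_martingale]). The product is between n^a and a
    multiple of n^a ([growth_ge], [growth_le]), so the increments are O(n^-a),
    and their squares are summable because p > p_c means 2a > 1. The martingale
    is therefore bounded in L^2, and the maximal inequality makes it converge
    almost surely ([martingale_ae_cvg]). The product over n^a has a positive
    limit ([growth_equiv]), so (S_n - n vmean) / n^a converges almost surely;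
    its limit is the vector L.

    L is not almost surely zero: boundedness in L^2 gives uniform
    integrability, so a martingale that tends to 0 almost surely vanishes on
    every history of positive probability ([martingale_ae_eq0]). Histories of
    length two of the form (i_0, j) have positive probability for every j, and
    there a coordinate of the martingale is g(i_0) + g(j) up to a factor.
    This would be 0 for every j, making each coordinate of the steps constant,
    against the injectivity of the step list. For the alternating walk the
    same argument runs on the pair of the two step sequences, which by
    independence is driven by the product kernel ([product_chain]), at histories
    along which only the first walk varies with j.

    The functional statement is then deterministic. If G(y) is the centred walk
    at real time y and L its limiting vector, then |G(y) - y^a L| is at most
    eps y^a + C for all y >= 0, and the substitution y = n t, divided by n^a,
    gives uniform convergence on compact sets, hence convergence for the
    Skorokhod topology with trivial time changes
    ([skorokhod_of_linear_correction]).

    All probabilities concern finitely many steps with finitely many values, so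
    conditional expectations are handled as finite sums over continuations of
    a history ([expect]) and tied to the measure by [chain_law]. *)

(** * Expectations over finite histories *)

Section Expectation.
Context {R : realType} {X : finType}.
Implicit Types (K : seq X -> X -> R) (F G M : seq X -> R) (T S : seq X).

(** The conditional expectation of F at the history extended by n further steps,
    given that the history so far is T. Recursion on the first of these steps
    makes the tower property and one-step arguments hold by induction. *)
Fixpoint expect K (n : nat) F T : R :=
  if n is n'.+1 then \sum_x K T x * expect K n' F (rcons T x) else F T.

Definition transition_kernel K : Prop :=
  (forall T x, 0 <= K T x) /\ (forall T, (0 < size T)%N -> \sum_x K T x = 1).

Definition martingale K M : Prop :=
  forall T, (0 < size T)%N -> \sum_x K T x * M (rcons T x) = M T.

Variable K : seq X -> X -> R.
Hypothesis K_kernel : transition_kernel K.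

Lemma le_expect n F G T :
  (forall S, size S = n -> F (T ++ S) <= G (T ++ S)) ->
  expect K n F T <= expect K n G T.
Proof.
elim: n T => [|n IH] T FG /=; first by have := FG [::] erefl; rewrite cats0.
apply: ler_sum => x _; apply: ler_wpM2l; first by case: K_kernel.
by apply: IH => S nS; rewrite cat_rcons; apply: FG; rewrite /= nS.
Qed.

Lemma expectD n F G T :
  expect K n (fun S => F S + G S) T = expect K n F T + expect K n G T.
Proof.
elim: n T => [//|n IH] T /=; rewrite -big_split /=.
by apply: eq_bigr => x _; rewrite IH mulrDr.
Qed.

Lemma expectZ n c F T : expect K n (fun S => c * F S) T = c * expect K n F T.
Proof.
elim: n T => [//|n IH] T /=; rewrite mulr_sumr.
by apply: eq_bigr => x _; rewrite IH mulrCA.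
Qed.

Lemma expect_cst n c T : (0 < size T)%N -> expect K n (fun=> c) T = c.
Proof.
elim: n T => [//|n IH] T T0 /=.
under eq_bigr do rewrite IH ?size_rcons //.
by rewrite -mulr_suml (proj2 K_kernel) // mul1r.
Qed.

Lemma expect_ge0 n F T : (0 < size T)%N -> (forall S, 0 <= F S) ->
  0 <= expect K n F T.
Proof. by move=> T0 F0; rewrite -(expect_cst n 0 T0); apply: le_expect. Qed.

Lemma expect_add n n' F T : expect K (n + n') F T = expect K n (expect K n' F) T.
Proof.
by elim: n T => [//|n IH] T /=; apply: eq_bigr => x _; rewrite IH.
Qed.

Lemma expect_martingale n M T : martingale K M -> (0 < size T)%N ->
  expect K n M T = M T.
Proof.
move=> HM; elim: n T => [//|n IH] T T0 /=.
by under eq_bigr do rewrite IH ?size_rcons //; exact: HM.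
Qed.

Lemma norm_expect_le n F T : `|expect K n F T| <= expect K n (fun S => `|F S|) T.
Proof.
elim: n T => [//|n IH] T /=.
apply: le_trans (ler_norm_sum _ _ _) _; apply: ler_sum => x _.
rewrite normrM ger0_norm; last by case: K_kernel.
by rewrite ler_wpM2l //; case: K_kernel.
Qed.

(* V is a potential: V n - V n.+1 bounds the square of the n-th increment, which
   replaces the summation of a series by a telescoping. *)
Section SquareIntegrable.
Variables (M : seq X -> R) (V : nat -> R).
Hypothesis M_martingale : martingale K M.
Hypothesis V_ge0 : forall n, 0 <= V n.
Hypothesis M_incr : forall T x, (0 < size T)%N ->
  (M (rcons T x) - M T) ^+ 2 <= V (size T) - V (size T).+1.

(** Pythagoras for one step: an increment of the martingale is centred, so it is
    orthogonal to M T - c. *)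
Lemma martingale_step_sqr c T : (0 < size T)%N ->
  \sum_x K T x * (M (rcons T x) - c) ^+ 2 =
  (M T - c) ^+ 2 + \sum_x K T x * (M (rcons T x) - M T) ^+ 2.
Proof.
move=> T0; have sK := (proj2 K_kernel) T T0; have sM := M_martingale T0.
have cross : \sum_x 2 * (M T - c) * (K T x * M (rcons T x) - K T x * M T) = 0.
  by rewrite -mulr_sumr sumrB -mulr_suml sM sK mul1r subrr mulr0.
rewrite -[X in X + _]mul1r -sK mulr_suml -big_split /= -[RHS]addr0 -[X in _ = _ + X]cross.
by rewrite -big_split /=; apply: eq_bigr => x _; ring.
Qed.

Lemma martingale_sqr_ge n c T : (0 < size T)%N ->
  (M T - c) ^+ 2 <= expect K n (fun S => (M S - c) ^+ 2) T.
Proof.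
elim: n T => [//|n IH] T T0 /=.
apply: (@le_trans _ _ (\sum_x K T x * (M (rcons T x) - c) ^+ 2)); last first.
  apply: ler_sum => x _; rewrite ler_wpM2l ?IH ?size_rcons //.
  by case: K_kernel.
rewrite martingale_step_sqr// lerDl sumr_ge0// => x _.
by rewrite mulr_ge0 ?sqr_ge0//; case: K_kernel.
Qed.

(** The increments of V dominate the conditional variances of the steps and
    telescope, so V n bounds the variance still to come after time n. *)
Lemma martingale_sqr_le n c T : (0 < size T)%N ->
  expect K n (fun S => (M S - c) ^+ 2) T <= (M T - c) ^+ 2 + V (size T).
Proof.
move=> T0; suff: expect K n (fun S => (M S - c) ^+ 2) T <=
    (M T - c) ^+ 2 + V (size T) - V (size T + n)%N.
  by move/le_trans; apply; rewrite gerBl.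
elim: n T T0 => [|n IH] T T0 /=; first by rewrite addn0 addrK.
have [K0 K1] := K_kernel; rewrite -addSnnS.
have H x : K T x * expect K n (fun S => (M S - c) ^+ 2) (rcons T x) <=
    K T x * (M (rcons T x) - c) ^+ 2
    + K T x * (V (size T).+1 - V ((size T).+1 + n)%N).
  by rewrite -mulrDr ler_wpM2l// addrA; have := IH (rcons T x);
     rewrite size_rcons => ->.
apply: le_trans (ler_sum _ (fun x _ => H x)) _.
rewrite big_split /= -mulr_suml K1// mul1r martingale_step_sqr//.
have: \sum_x K T x * (M (rcons T x) - M T) ^+ 2 <= V (size T) - V (size T).+1.
  rewrite -[leRHS]mul1r -(K1 T T0) mulr_suml ler_sum// => x _.
  by rewrite ler_wpM2l// M_incr.
lra.
Qed.

Definition leaves c (e : R) T S : bool :=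
  has (fun k => e <= `|M (take k S) - c|) (iota (size T) (size S - size T).+1).

(** Kolmogorov's maximal inequality. Induction on the number of steps plays the
    role of the stopping time: if the deviation is already reached at T, the
    submartingale property of (M - c)^2 bounds e^2 from T on; otherwise the
    event is decided after the first step, where the induction hypothesis
    applies. *)
Lemma kolmogorov_ineq n c (e : R) T : (0 < size T)%N -> 0 <= e ->
  expect K n (fun S => (leaves c e T S)%:R) T * e ^+ 2
    <= expect K n (fun S => (M S - c) ^+ 2) T.
Proof.
move=> T0 e0; have [K0 K1] := K_kernel.
elim: n T T0 => [|n IH] T T0.
  rewrite /= /leaves subnn /= take_size orbF.
  case: (leP e _) => [eM|_]; rewrite ?mul1r ?mul0r ?sqr_ge0//.
  by rewrite -(real_normK (num_real (M T - c))) ler_pXn2r ?nnegrE.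
have [eM|eM] := leP e `|M T - c|.
  apply: (@le_trans _ _ (e ^+ 2)).
    rewrite ler_piMl ?sqr_ge0// -[leRHS](expect_cst n.+1 1 T0).
    by apply: le_expect => S _; case: leaves; rewrite ?ler01.
  apply: le_trans (martingale_sqr_ge _ _ T0).
  by rewrite -(real_normK (num_real (M T - c))) ler_pXn2r ?nnegrE.
rewrite /= mulr_suml ler_sum// => x _; rewrite -mulrA ler_wpM2l//.
apply: le_trans (IH _ _); last by rewrite size_rcons.
rewrite ler_wpM2r ?sqr_ge0//; apply: le_expect => S nS.
rewrite /leaves size_cat !size_rcons nS addSn subSn ?leq_addr// subSS.
have -> : (size T + n - size T)%N = n by lia.
by rewrite /= cat_rcons take_size_cat// (lt_geF eM).
Qed.

(** The maximal inequality started at time N and centred at the value there: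
    condition on the first N steps and apply it to each continuation. *)
Lemma expect_leaves_le n N (e : R) T0 : 0 < e -> (0 < size T0)%N ->
  expect K (N + n) (fun S =>
    (has (fun k => e <= `|M (take k S) - M (take (size T0 + N) S)|)
         (iota (size T0 + N) n.+1))%:R) T0 * e ^+ 2 <= V (size T0 + N).
Proof.
move=> e0 T0_gt0; rewrite expect_add mulrC -expectZ.
rewrite -[leRHS](expect_cst N _ T0_gt0).
apply: le_expect => T NT; set S0 := T0 ++ T.
have sS0 : size S0 = (size T0 + N)%N by rewrite size_cat NT.
have S0_gt0 : (0 < size S0)%N by rewrite sS0 ltn_addr.
rewrite mulrC.
have := le_trans (kolmogorov_ineq n (M S0) S0_gt0 (ltW e0))
  (martingale_sqr_le n (M S0) S0_gt0).
rewrite subrr expr0n /= add0r sS0.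
apply: le_trans; rewrite ler_wpM2r ?sqr_ge0//.
apply: le_expect => S nS; rewrite /leaves size_cat nS sS0 -sS0.
have -> : (size S0 + n - size S0)%N = n by lia.
by rewrite /= take_size_cat.
Qed.

End SquareIntegrable.
End Expectation.

(** * Processes governed by a transition kernel *)

Section History.
Context {X : finType} {Omega : Type}.
Variable xi : nat -> Omega -> X.

Definition history (n : nat) (w : Omega) : seq X := [seq xi k w | k <- iota 0 n].

Lemma historyS n w : history n.+1 w = rcons (history n w) (xi n w).
Proof. by rewrite /history -addn1 iotaD map_cat cats1. Qed.

Lemma size_history n w : size (history n w) = n.
Proof. by rewrite size_map size_iota. Qed.

Lemma take_history k n w : (k <= n)%N -> take k (history n w) = history k w.
Proof. by move=> kn; rewrite /history -map_take take_iota (minn_idPl kn). Qed.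

End History.

(** Stated for every measurable structure because it is used both with the
    ambient events and with the sigma-algebra generated by one process. *)
Lemma measurable_history {d : measure_display} {Omega : measurableType d}
    {X : finType} (xi : nat -> Omega -> X) :
  (forall n x, measurable (xi n @^-1` [set x])) ->
  forall n (A : set (seq X)), measurable (history xi n @^-1` A).
Proof.
move=> mxi; elim=> [|n IH] A.
  have [A0|A0] := pselect (A [::]).
    by rewrite (_ : _ @^-1` _ = setT) //; apply/seteqP; split.
  by rewrite (_ : _ @^-1` _ = set0) //; apply/seteqP; split.
rewrite (_ : _ @^-1` _ = \bigcup_(x in [set: X])
   (xi n @^-1` [set x] `&` history xi n @^-1` [set T | A (rcons T x)])).
  by apply: fin_bigcup_measurable => // x _; apply: measurableI.
apply/seteqP; split => w /=; rewrite historyS.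
  by move=> Aw; exists (xi n w).
by move=> [x _ [/= <-]].
Qed.

Lemma measure_bigcup_finType {d : measure_display} {R : realFieldType}
    {Omega : measurableType d} (mu : {measure set Omega -> \bar R})
    {X : finType} (F : X -> set Omega) :
  (forall x, measurable (F x)) -> trivIset setT F ->
  mu (\bigcup_x F x) = (\sum_x mu (F x))%E.
Proof.
move=> mF tF; rewrite measure_fin_bigcup//; last exact: finite_finset.
rewrite [RHS](fsbig_seq _ _ (index_enum_uniq X)); apply: eq_fsbigl.
by apply/seteqP; split => x _ //=; rewrite mem_index_enum.
Qed.

Section Chain.
Context {R : realType} {X : finType} {dO : measure_display}.
Context {Omega : measurableType dO} (P : probability Omega R).
Implicit Types (K : seq X -> X -> R) (M : seq X -> R) (T S : seq X).

Definition chain K (x0 : X) (xi : nat -> Omega -> X) : Prop :=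
  [/\ forall n x, measurable (xi n @^-1` [set x]),
      forall w, xi 0 w = x0
    & forall T x, (0 < size T)%N ->
        P (history xi (size T).+1 @^-1` [set rcons T x]) =
        (P (history xi (size T) @^-1` [set T]) * (K T x)%:E)%E].

Variables (K : seq X -> X -> R) (x0 : X) (xi : nat -> Omega -> X).
Hypothesis K_kernel : transition_kernel K.
Hypothesis xi_chain : chain K x0 xi.

Let mxi n (A : set (seq X)) : measurable (history xi n @^-1` A).
Proof. by apply: measurable_history; case: xi_chain. Qed.

(** The bridge between the measure and [expect], by total probability over the
    next step. *)
Lemma chain_law n T (A : pred (seq X)) : (0 < size T)%N ->
  P [set w | history xi (size T) w = T /\ A (history xi (size T + n) w)] =
  (P (history xi (size T) @^-1` [set T])
     * (expect K n (fun S => (A S)%:R) T)%:E)%E.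
Proof.
elim: n T => [|n IH] T T0.
  rewrite addn0 /=; have [AT|AT] := boolP (A T).
    rewrite mule1; congr (P _); apply/seteqP.
    by split => w /= => [[]//|HT]; rewrite HT.
  rewrite mule0 (_ : [set w | _] = set0) ?measure0//.
  by apply/seteqP; split => w //= [->]; rewrite (negPf AT).
rewrite (_ : [set w | _] = \bigcup_(x in [set: X])
   [set w | history xi (size T).+1 w = rcons T x /\
            A (history xi ((size T).+1 + n) w)]); last first.
  apply/seteqP; split => w /=.
    by move=> [HT Aw]; exists (xi (size T) w) => //=; rewrite historyS HT addSnnS.
  by move=> [x _ /=]; rewrite historyS addSnnS => -[/rcons_inj [-> _]].
rewrite measure_bigcup_finType; last 2 first.
- move=> x; rewrite (_ : [set w | _] =
    history xi (size T).+1 @^-1` [set rcons T x] `&`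
    history xi ((size T).+1 + n) @^-1` [set S | A S])//.
  exact: measurableI.
- by move=> x y _ _ [w /= [[-> _]] [/rcons_inj[]]].
rewrite -sumEFin ge0_sume_distrr; last first.
  move=> x _; rewrite lee_fin mulr_ge0//; first by case: K_kernel.
  by rewrite expect_ge0 ?size_rcons// => S; exact: ler0n.
apply: eq_bigr => x _.
have := IH (rcons T x); rewrite size_rcons => /(_ isT) H.
apply: etrans H _.
by case: xi_chain => _ _ ->//; rewrite EFinM muleA.
Qed.

Lemma chain_law0 n (A : pred (seq X)) :
  P [set w | A (history xi n.+1 w)] =
  (expect K n (fun S => (A S)%:R) [:: x0])%:E.
Proof.
have h1 w : history xi 1 w = [:: x0].
  by rewrite /history /=; case: xi_chain => _ ->.
rewrite -[RHS]mul1e -(@probability_setT _ _ _ P).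
have := @chain_law n [:: x0] A erefl; rewrite /= add1n => H.
rewrite (_ : setT = history xi 1 @^-1` [set [:: x0]]).
  by rewrite -H; congr (P _); apply/seteqP; split => w /=; [split|case].
by apply/seteqP; split => w //= _; rewrite h1.
Qed.

Lemma chain_two_steps x :
  P (history xi 2 @^-1` [set [:: x0; x]]) = (K [:: x0] x)%:E.
Proof.
have := @chain_law0 1 (pred1 [:: x0; x]).
rewrite (_ : [set w | _] = history xi 2 @^-1` [set [:: x0; x]]); last first.
  by apply/seteqP; split => w /=; move/eqP.
move=> ->; congr EFin; rewrite /= (bigD1 x)//= eqxx mulr1 big1 ?addr0//.
by move=> y yx; rewrite eqseq_cons eqxx eqseq_cons (negPf yx) mulr0.
Qed.

Section Martingale.
Variables (M : seq X -> R) (V : nat -> R).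
Hypothesis M_martingale : martingale K M.
Hypothesis V_ge0 : forall n, 0 <= V n.
Hypothesis V_cvg0 : V @ \oo --> 0.
Hypothesis M_incr : forall T x, (0 < size T)%N ->
  (M (rcons T x) - M T) ^+ 2 <= V (size T) - V (size T).+1.

Let Z n w := M (history xi n w).

Definition fluctuates (e : R) N : set Omega :=
  [set w | exists2 k, (N <= k)%N & e <= `|Z k w - Z N w|].

Let fluctuates_upto (e : R) N n : set Omega :=
  [set w | exists2 k, (N <= k <= N + n)%N & e <= `|Z k w - Z N w|].

Let fluctuates_uptoE (e : R) N n : fluctuates_upto e N n =
  [set w | has (fun k => e <= `|M (take k (history xi (N + n) w))
              - M (take N (history xi (N + n) w))|) (iota N n.+1)].
Proof.
suff HE w : fluctuates_upto e N n w <->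
    has (fun k => e <= `|M (take k (history xi (N + n) w))
              - M (take N (history xi (N + n) w))|) (iota N n.+1).
  by apply/seteqP; split => w /HE.
split=> [[k /andP[Nk kn] ek]|/hasP[k]].
  apply/hasP; exists k; last by rewrite !take_history ?leq_addr.
  by rewrite mem_iota addnS ltnS Nk.
rewrite mem_iota addnS ltnS => /andP[Nk kn].
by rewrite !take_history ?leq_addr// => ek; exists k => //; rewrite Nk.
Qed.

Let measurable_fluctuates_upto e N n : measurable (fluctuates_upto e N n).
Proof.
rewrite fluctuates_uptoE.
exact: (@mxi _ [set S | has (fun k => e <= `|M (take k S) - M (take N S)|)
   (iota N n.+1)]).
Qed.

Let fluctuates_bigcup e N : fluctuates e N = \bigcup_n fluctuates_upto e N n.
Proof.
apply/seteqP; split => w /=.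
  by move=> [k Nk ek]; exists k => //; exists k => //; rewrite Nk leq_addl.
by move=> [n _ [k /andP[Nk _] ek]]; exists k.
Qed.

Lemma measurable_fluctuates e N : measurable (fluctuates e N).
Proof. by rewrite fluctuates_bigcup; exact: bigcup_measurable. Qed.

(** [expect_leaves_le] bounds the oscillation over finite windows uniformly in
    their length; continuity from below passes to the infinite window. *)
Lemma fluctuates_le (e : R) N : 0 < e ->
  (P (fluctuates e N.+1) <= (V N.+1 / e ^+ 2)%:E)%E.
Proof.
move=> e0.
have Hn n : (P (fluctuates_upto e N.+1 n) <= (V N.+1 / e ^+ 2)%:E)%E.
  pose A S := has (fun k => e <= `|M (take k S) - M (take N.+1 S)|)
                  (iota N.+1 n.+1).
  have -> : P (fluctuates_upto e N.+1 n) =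
      (expect K (N + n) (fun S => (A S)%:R) [:: x0])%:E.
    by rewrite fluctuates_uptoE -chain_law0.
  rewrite lee_fin ler_pdivlMr ?exprn_gt0//.
  exact: (@expect_leaves_le _ _ _ K_kernel _ _ M_martingale V_ge0 M_incr
    n N e [:: x0]).
have H : P (fluctuates_upto e N.+1 n) @[n --> \oo] --> P (fluctuates e N.+1).
  rewrite fluctuates_bigcup; apply: nondecreasing_cvg_mu => //.
    by rewrite -fluctuates_bigcup; exact: measurable_fluctuates.
  move=> n n' nn'; apply/subsetPset => w [k /andP[Nk kn] ek].
  by exists k => //; rewrite Nk (leq_trans kn)// leq_add2l.
rewrite -(cvg_lim _ H)//; apply: lime_le; first by apply/cvg_ex; eexists; exact: H.
by apply: nearW.
Qed.

(** Convergence of L^2-bounded martingales: V tends to 0, so for each threshold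
    the event of fluctuating beyond it after every time is null, and outside
    countably many null events the path is Cauchy. *)
Lemma martingale_ae_cvg : {ae P, forall w, cvg (Z n w @[n --> \oo])}.
Proof.
pose D j := \bigcap_N fluctuates j.+1%:R^-1 N.+1.
have mD j : measurable (D j).
  by apply: bigcap_measurable => // N _; exact: measurable_fluctuates.
have PD j : P (D j) = 0%E.
  apply/eqP; rewrite eq_le measure_ge0 andbT; apply/lee_addgt0Pr => e e0.
  rewrite add0e; set c : R := j.+1%:R^-1.
  have c0 : 0 < c ^+ 2 by rewrite exprn_gt0// invr_gt0 ltr0n.
  have : \forall N \near \oo, `|V N| < e * c ^+ 2.
    by move/cvgr0Pnorm_lt : V_cvg0; apply; rewrite mulr_gt0.
  move=> [N _ /(_ N.+1 (leqnSn N))] VN.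
  apply: (@le_trans _ _ (P (fluctuates c N.+1))).
    apply: le_measure; rewrite ?inE//; first exact: measurable_fluctuates.
    by move=> w /(_ N I).
  apply: (le_trans (fluctuates_le N _)); first by rewrite invr_gt0 ltr0n.
  by rewrite lee_fin ler_pdivrMr// (le_trans (ler_norm _))// ltW.
apply: (negligibleS (A := \bigcup_j D j)); last first.
  apply: negligible_bigcup => j; apply/negligibleP; first exact: mD.
  exact: PD.
move=> w /= ncvg; apply: contrapT => nD; apply: ncvg.
apply: cauchy_cvg; apply/cauchyP => e e0.
have [j _ /(_ j (leqnn j)) /= je] := near_infty_natSinv_lt (PosNum e0).
have : exists N, ~ fluctuates j.+1%:R^-1 N.+1 w.
  apply: contrapT => nN; apply: nD; exists j => // N _.
  by apply: contrapT => h; apply: nN; exists N.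
move=> [N NN]; exists (Z N.+1 w); exists N.+1 => // k /= Nk.
apply: lt_trans je; rewrite distrC ltNge; apply/negP => h; apply: NN.
by exists k.
Qed.

(** Quantitative uniform integrability: |x| is at most e where |x| <= e, and at
    most del x^2 + 1/del elsewhere. *)
Lemma expect_norm_le n (e del : R) T : 0 < e -> 0 < del -> (0 < size T)%N ->
  expect K n (fun S => `|M S|) T <=
  e + del * (M T ^+ 2 + V (size T))
    + del^-1 * expect K n (fun S => (e < `|M S|)%R%:R) T.
Proof.
move=> e0 d0 T0.
apply: (@le_trans _ _ (expect K n
    (fun S => e + del * (M S - 0) ^+ 2 + del^-1 * (e < `|M S|)%R%:R) T)).
  apply: (le_expect K_kernel) => S _; rewrite subr0 -(real_normK (num_real (M _))).
  move: (normr_ge0 (M (T ++ S))); set y := `|_| => y0.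
  have [ye|ye] := leP y e.
    by rewrite mulr0 addr0 (le_trans ye)// lerDl mulr_ge0// ?sqr_ge0// ltW.
  rewrite mulr1 -subr_ge0.
  (* the square absorbs the cross term 2 y, which leaves e + y to spare *)
  have -> : e + del * y ^+ 2 + del^-1 - y =
      e + y + del * (y - del^-1) ^+ 2.
    by field; rewrite gt_eqF.
  rewrite addr_ge0 //; first by rewrite addr_ge0 ?(ltW e0).
  by rewrite mulr_ge0 ?sqr_ge0 ?(ltW d0).
rewrite 2!expectD expectZ expectZ expect_cst// lerD2r lerD2l ler_wpM2l ?(ltW d0)//.
have := @martingale_sqr_le _ _ _ K_kernel _ _ M_martingale V_ge0 M_incr n 0 _ T0.
by rewrite subr0.
Qed.

(** M T is the conditional mean of every later value. These values tend to 0 in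
    probability and are bounded in L^2 given T, so their conditional means tend
    to 0 as well. *)
Lemma martingale_ae_eq0 T : (0 < size T)%N ->
  P (history xi (size T) @^-1` [set T]) != 0%E ->
  {ae P, forall w, Z n w @[n --> \oo] --> 0} -> M T = 0.
Proof.
move=> T0 PT Z0; apply/eqP/contraT => MT.
have [eta0 K0] : 0 < `|M T| /\ 0 <= M T ^+ 2 + V (size T).
  by rewrite normr_gt0 addr_ge0 ?sqr_ge0.
set Kc := M T ^+ 2 + _ in K0.
(* e and del each claim a quarter of |M T| in [expect_norm_le], so the
   probability term must carry the remaining half for every n *)
pose e := `|M T| / 4; pose del := `|M T| / (4 * (Kc + 1)).
have e0 : 0 < e by rewrite divr_gt0.
have d0 : 0 < del by rewrite divr_gt0// mulr_gt0// ltr_wpDl.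
have dK : del * Kc <= e.
  rewrite /del /e invfM mulrA -mulrA ler_piMr// ?(ltW eta0).
  by rewrite mulrC ler_pdivrMr ?mul1r ?ltr_wpDl// lerDl.
pose B n := [set w | e < `|Z n w|].
have mB n : measurable (B n) by exact: (@mxi n [set S | e < `|M S|]).
pose U n := \bigcup_(k in [set k | (n <= k)%N]) B k.
have mU n : measurable (U n) by exact: bigcup_measurable.
have U0 : P (U n) @[n --> \oo] --> 0%E.
  have <- : P (lim_sup_set B) = 0%E.
    apply/negligibleP.
      by apply: bigcap_measurable => // n _; exact: mU.
    apply: negligibleS Z0 => w BU /= /cvgr0Pnorm_lt/(_ _ e0)[n _ nZ].
    have [k /= nk] := BU n I.
    by rewrite /B /= ltNge ltW// nZ.
  apply: lim_sup_set_cvg => //.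
  exact: le_lt_trans (probability_le1 P (mU 0%N)) (ltry _).
have PfinT : P (history xi (size T) @^-1` [set T]) \is a fin_num.
  exact: fin_num_measure.
pose q := fine (P (history xi (size T) @^-1` [set T])).
have q0 : 0 < q by rewrite fine_gt0// lt0e PT measure_ge0 ltey_eq PfinT.
pose c := q * (del * (`|M T| / 2)).
have c0 : 0 < c by rewrite /c mulr_gt0// mulr_gt0// divr_gt0.
have cU n : (c%:E <= P (U (size T + n)%N))%E.
  pose x := expect K n (fun S => (e < `|M S|)%R%:R) T.
  have xE := chain_law n (fun S => e < `|M S|) T0.
  apply: (@le_trans _ _ (q * x)%:E).
    rewrite lee_fin ler_pM2l// mulrC -ler_pdivlMr// mulrC.
    have := norm_expect_le K_kernel n M T; rewrite expect_martingale//.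
    move/le_trans => /(_ _ (expect_norm_le n e0 d0 T0)); rewrite -/Kc -/x.
    by move: dK; rewrite /e; lra.
  rewrite EFinM fineK// -xE; apply: le_measure; rewrite ?inE//.
    exact: measurableI (mxi _ [set T]) (mxi _ [set S | e < `|M S|]).
  by move=> w [_ ew]; exists (size T + n)%N => /=.
have : (c%:E <= 0)%E.
  rewrite -(cvg_lim _ U0)//; apply: lime_ge; first by apply/cvg_ex; exists 0%E.
  exists (size T) => // n /= nT.
  by have := cU (n - size T)%N; rewrite subnKC.
by rewrite lee_fin leNgt c0.
Qed.

End Martingale.

End Chain.

(** * Growth of the normalising products *)

Section Growth.
Context {R : realType}.
Implicit Types a x y : R.

(** Young's inequality for (1 + x)^a and 1 with the exponents 1/a and
    1/(1 - a). *)
Lemma powR_bernoulli a x : 0 < a -> a < 1 -> -1 <= x ->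
  (1 + x) `^ a <= 1 + a * x.
Proof.
move=> a0 a1 x1; have x0 : 0 <= 1 + x by lra.
have pq : a^-1^-1 + (1 - a)^-1^-1 = 1 by rewrite !invrK addrC subrK.
have := conjugate_powR (powR_ge0 (1 + x) a) ler01 _ _ pq.
rewrite !invrK mulr1 -powRrM mulfV ?gt_eqF// powRr1// powR1.
rewrite !invr_gt0 subr_gt0 => /(_ a0 a1); lra.
Qed.

Variable a : R.
Hypotheses (a_gt0 : 0 < a) (a_lt1 : a < 1).

(** [growth n] normalises histories of length n.+1; it is
    Gamma(n + 1 + a) / (Gamma(n + 1) Gamma(1 + a)). *)
Definition growth (n : nat) : R := \prod_(k < n) (1 + a / k.+1%:R).

Lemma growthS n : growth n.+1 = growth n * (1 + a / n.+1%:R).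
Proof. by rewrite /growth big_ord_recr. Qed.

Lemma growth_gt0 n : 0 < growth n.
Proof.
by apply: prodr_gt0 => k _; rewrite addr_gt0// divr_gt0// ltr0n.
Qed.

Lemma growth_ratio_nondecreasing :
  nondecreasing_seq (fun n => growth n / n.+1%:R `^ a).
Proof.
apply/nondecreasing_seqP => n; rewrite growthS.
rewrite -[leRHS]mulrA ler_pM2l ?growth_gt0// ler_pdivlMr ?powR_gt0 ?ltr0n//.
rewrite mulrC ler_pdivrMr ?powR_gt0 ?ltr0n// mulrC.
have -> : n.+2%:R = n.+1%:R * (1 + n.+1%:R^-1) :> R.
  by rewrite mulrDr mulr1 mulfV ?pnatr_eq0// natr1.
rewrite powRM ?ler0n ?addr_ge0 ?invr_ge0 ?ler0n// ler_pM2l ?powR_gt0 ?ltr0n//.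
apply: powR_bernoulli => //; apply: (@le_trans _ _ 0); first by lra.
by rewrite invr_ge0 ler0n.
Qed.

Lemma growth_ge n : n.+1%:R `^ a <= growth n.
Proof.
have := growth_ratio_nondecreasing (leq0n n).
by rewrite /growth big_ord0 powR1 divr1 ler_pdivlMr ?mul1r// powR_gt0 ?ltr0n.
Qed.

(** Induction: Bernoulli at x = - 1/(n+2) gives
    (1 + a / (n+2)) ((n+1)/(n+2))^a <= 1 - (a / (n+2))^2 <= 1. *)
Lemma growth_le n : growth n.+1 <= (1 + a) * n.+1%:R `^ a.
Proof.
elim: n => [|n IH]; first by rewrite growthS /growth big_ord0 divr1 powR1; lra.
have n2 : (0 : R) < n.+2%:R by rewrite ltr0n.
have shrink : n.+1%:R = n.+2%:R * (1 - n.+2%:R^-1) :> R.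
  by rewrite mulrBr mulr1 mulfV ?pnatr_eq0// -[n.+2%:R]natr1 addrK.
have /andP[inv0 inv1] : 0 < (n.+2%:R : R)^-1 <= 1.
  by apply/andP; split; [rewrite invr_gt0 | rewrite invf_le1 ?ler1n].
rewrite growthS; apply: (@le_trans _ _
   ((1 + a) * n.+1%:R `^ a * (1 + a / n.+2%:R))).
  by rewrite ler_wpM2r// addr_ge0// divr_ge0 ?ltW.
rewrite -mulrA ler_wpM2l ?addr_ge0 ?(ltW a_gt0)// shrink powRM ?(ltW n2)//;
  last by rewrite subr_ge0.
rewrite -mulrA ler_piMr ?powR_ge0//; move: inv0 inv1.
set i := n.+2%:R^-1 => i0 i1.
apply: (@le_trans _ _ ((1 + a * - i) * (1 + a * i))).
  rewrite ler_wpM2r ?addr_ge0 ?mulr_ge0 ?(ltW i0) ?(ltW a_gt0)//.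
  by apply: powR_bernoulli => //; rewrite lerN2.
by have := sqr_ge0 (a * i); lra.
Qed.

Lemma growth_equiv : exists2 gam : R, 0 < gam &
  growth n / n.+1%:R `^ a @[n --> \oo] --> gam.
Proof.
have H : has_ubound (range (fun n => growth n / n.+1%:R `^ a)).
  exists (1 + a) => _ [[|n] _ <-].
    by rewrite /growth big_ord0 powR1 divr1 lerDl ltW.
  rewrite ler_pdivrMr ?powR_gt0 ?ltr0n// (le_trans (growth_le n))//.
  rewrite ler_wpM2l ?addr_ge0 ?(ltW a_gt0)//.
  by apply: ge0_ler_powR; rewrite ?nnegrE ?ler0n ?ler_nat// ltW.
have cv := nondecreasing_is_cvgn growth_ratio_nondecreasing H.
exists (limn (fun n => growth n / n.+1%:R `^ a)) => //.
apply: (@lt_le_trans _ _ 1) => //; apply: limr_ge => //.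
by apply: nearW => n; rewrite ler_pdivlMr ?mul1r ?growth_ge// powR_gt0 ?ltr0n.
Qed.

End Growth.

(** The summability of n^-(1+c), as a comparison with the telescoping n^-c. *)
Lemma powR_diff_ge {R : realType} (c : R) n : 0 < c -> c < 1 -> (0 < n)%N ->
  c / (n.+1%:R `^ c * n.+1%:R) <= (n%:R `^ c)^-1 - (n.+1%:R `^ c)^-1.
Proof.
move=> c0 c1 n0; have [nc0 Nc0] : 0 < n%:R `^ c /\ 0 < n.+1%:R `^ c.
  by rewrite !powR_gt0 ?ltr0n.
have N0 : (0 : R) < n.+1%:R by rewrite ltr0n.
have shrink : n%:R = n.+1%:R * (1 - n.+1%:R^-1) :> R.
  by rewrite mulrBr mulr1 mulfV ?pnatr_eq0// -[n.+1%:R]natr1 addrK.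
have /andP[inv0 inv1] : 0 < (n.+1%:R : R)^-1 <= 1.
  by apply/andP; split; [rewrite invr_gt0 | rewrite invf_le1 ?ler1n].
have b : n%:R `^ c <= n.+1%:R `^ c * (1 - c / n.+1%:R).
  rewrite {1}shrink powRM ?(ltW N0)//; last by rewrite subr_ge0.
  by rewrite ler_wpM2l ?(ltW Nc0)// -mulrN powR_bernoulli// lerN2.
have -> : (n%:R `^ c)^-1 - (n.+1%:R `^ c)^-1 =
    (n.+1%:R `^ c - n%:R `^ c) / (n%:R `^ c * n.+1%:R `^ c).
  by field; rewrite !gt_eqF.
rewrite ler_pdivlMr ?mulr_gt0//.
apply: (@le_trans _ _ (c / n.+1%:R * n.+1%:R `^ c)); last first.
  by move: b; set x := c / _; set A := n%:R `^ c; set B := _ `^ c; lra.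
have -> : c / (n.+1%:R `^ c * n.+1%:R) * (n%:R `^ c * n.+1%:R `^ c) =
    c / n.+1%:R * n%:R `^ c by field; rewrite !gt_eqF.
by rewrite ler_pM2l ?divr_gt0// ge0_ler_powR ?nnegrE ?ler0n ?ler_nat// ltW.
Qed.

Lemma powR_natV_cvg0 {R : realType} (c : R) : 0 < c ->
  (n%:R `^ c)^-1 @[n --> \oo] --> 0.
Proof.
move=> c0; apply/cvgr0Pnorm_lt => e e0; near=> n.
have en : e^-1 `^ c^-1 < n%:R by near: n; exact: nbhs_infty_gtr.
have ei : e^-1 < n%:R `^ c.
  have := gt0_ltr_powR c0 (powR_ge0 _ _) (ler0n _ n) en.
  by rewrite -powRrM mulVf ?gt_eqF// powRr1// invr_ge0 ltW.
rewrite ger0_norm ?invr_ge0 ?powR_ge0// invf_plt ?posrE//.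
by apply: lt_trans ei; rewrite invr_gt0.
Unshelve. all: by end_near. Qed.

(** * The elephant kernel and its martingales *)

Section ElephantKernel.
Context {R : realType} {m : nat} (p : R).

Definition step_prob (i j : 'I_m) : R :=
  if i == j then p else (1 - p) / (m%:R - 1).

Definition erw_kernel (T : seq 'I_m) (i : 'I_m) : R :=
  (size T)%:R^-1 * \sum_(j <- T) step_prob i j.

Hypotheses (m_gt1 : (1 < m)%N) (p_gt0 : 0 < p) (p_lt1 : p < 1).

Let m1_gt0 : 0 < m%:R - 1 :> R.
Proof. by rewrite subr_gt0 ltr1n. Qed.

Lemma step_prob_gt0 i j : 0 < step_prob i j.
Proof. by rewrite /step_prob; case: ifP => // _; rewrite divr_gt0 ?m1_gt0 ?subr_gt0. Qed.

(** This is where the exponent a comes from: up to a constant function, one draw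
    of the elephant acts on functions of the step as multiplication by a. *)
Lemma sum_step_prob (g : 'I_m -> R) j :
  \sum_i step_prob i j * g i =
  (m%:R * p - 1) / (m%:R - 1) * g j + (1 - p) / (m%:R - 1) * \sum_i g i.
Proof.
rewrite (bigD1 j)//= [X in _ + _ * X](bigD1 j)//= /step_prob eqxx.
rewrite (eq_bigr (fun i => (1 - p) / (m%:R - 1) * g i)); last first.
  by move=> i /negPf ->.
by rewrite -mulr_sumr; field; rewrite gt_eqF.
Qed.

Lemma erw_kernelE (g : 'I_m -> R) T :
  \sum_i erw_kernel T i * g i =
  (size T)%:R^-1 * \sum_(j <- T) \sum_i step_prob i j * g i.
Proof.
rewrite exchange_big mulr_sumr /=; apply: eq_bigr => i _.
by rewrite /erw_kernel -mulrA mulr_suml.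
Qed.

Lemma erw_kernel_transition : transition_kernel erw_kernel.
Proof.
split=> [T i|T T0].
  by rewrite mulr_ge0 ?invr_ge0 ?ler0n// sumr_ge0// => j _; exact/ltW/step_prob_gt0.
under eq_bigr do rewrite -[erw_kernel T _]mulr1.
rewrite (erw_kernelE (fun=> 1)).
rewrite (eq_bigr (fun=> 1)); last first.
  move=> j _; rewrite sum_step_prob sumr_const card_ord mulr1.
  by field; rewrite gt_eqF.
by rewrite big_const_seq count_predT iter_addr_0 mulVf// pnatr_eq0 -lt0n.
Qed.

Lemma erw_kernel_gt0 T i : (0 < size T)%N -> 0 < erw_kernel T i.
Proof.
case: T => // j T _; rewrite mulr_gt0 ?invr_gt0 ?ltr0n// big_cons.
by rewrite ltr_pwDl ?step_prob_gt0// sumr_ge0// => k _; exact/ltW/step_prob_gt0.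
Qed.

Variable a : R.
Hypothesis aE : a = (m%:R * p - 1) / (m%:R - 1).
Hypotheses (a_gt : 1 < 2 * a) (a_lt1 : a < 1).

Let a_gt0 : 0 < a. Proof. by rewrite -(@pmulr_rgt0 _ 2) ?ltr0n// (lt_trans ltr01). Qed.

Definition erw_mart (g : 'I_m -> R) (T : seq 'I_m) : R :=
  (\sum_(j <- T) g j) / growth a (size T).-1.

Variable g : 'I_m -> R.
Hypothesis g_sum0 : \sum_i g i = 0.

Lemma erw_mart_martingale : martingale erw_kernel (erw_mart g).
Proof.
move=> T T0; set F := \sum_(j <- T) g j.
have [K0 /(_ T T0) K1] := erw_kernel_transition.
have KF : \sum_i erw_kernel T i * g i = a / (size T)%:R * F.
  rewrite erw_kernelE; under eq_bigr do rewrite sum_step_prob g_sum0 mulr0 addr0 -aE.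
  by rewrite -mulr_sumr mulrCA mulrA.
have [N sT] : exists N, size T = N.+1 by exists (size T).-1; rewrite prednK.
rewrite sT in KF.
have G0 := growth_gt0 a_gt0 N.
have H0 : 0 < 1 + a / N.+1%:R by rewrite addr_gt0// divr_gt0// ltr0n.
rewrite (eq_bigr (fun i => (erw_kernel T i * g i + erw_kernel T i * F)
                           / growth a N.+1)); last first.
  by move=> i _; rewrite /erw_mart size_rcons big_rcons sT -/F mulrA mulrDr addrC.
rewrite -mulr_suml big_split /= -mulr_suml K1 mul1r KF growthS.
rewrite -[X in _ + X]mul1r -mulrDl [_ + 1]addrC /erw_mart sT -/F.
move: H0 G0 => /=; set D := 1 + _; set G := growth a N => D0 G0.
by field; rewrite !gt_eqF.
Qed.

(** With increments at most 2 B (n+1)^-a, the squares are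
    4 B^2 (n+1)^-(1+c) for c = 2 a - 1, and [powR_diff_ge] dominates them by the
    decrements of 4 B^2 / c times n^-c. *)
Definition potential (B : R) (n : nat) : R :=
  4 * B ^+ 2 / (2 * a - 1) * (n%:R `^ (2 * a - 1))^-1.

Lemma potential_ge0 B n : 0 <= potential B n.
Proof.
rewrite mulr_ge0 ?invr_ge0 ?powR_ge0// divr_ge0//.
  exact: mulr_ge0 (ler0n _ 4) (sqr_ge0 B).
by rewrite subr_ge0 ltW.
Qed.

Lemma potential_cvg0 B : potential B @ \oo --> 0.
Proof.
rewrite -[X in _ --> X](mulr0 (4 * B ^+ 2 / (2 * a - 1))).
by apply: cvgMr; apply: powR_natV_cvg0; rewrite subr_gt0.
Qed.

Lemma erw_mart_incr B T i : (forall j, `|g j| <= B) -> (0 < size T)%N ->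
  (erw_mart g (rcons T i) - erw_mart g T) ^+ 2 <=
  potential B (size T) - potential B (size T).+1.
Proof.
move=> gB T0; have B0 : 0 <= B by apply: le_trans (gB i).
have [N sT] : exists N, size T = N.+1 by exists (size T).-1; rewrite prednK.
rewrite sT.
set F := \sum_(j <- T) g j.
have FB : `|F| <= N.+1%:R * B.
  rewrite -sT; apply: le_trans (ler_norm_sum _ _ _) _.
  rewrite (le_trans (ler_sum _ (fun j _ => gB j)))//.
  by rewrite big_const_seq count_predT iter_addr_0 mulr_natl.
have G0 := growth_gt0 a_gt0 N; have G1 := growth_gt0 a_gt0 N.+1.
have H0 : 0 < 1 + a / N.+1%:R by rewrite addr_gt0// divr_gt0// ltr0n.
have -> : erw_mart g (rcons T i) - erw_mart g T =
    (g i - a * (F / N.+1%:R)) / growth a N.+1.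
  rewrite /erw_mart size_rcons big_rcons sT /= growthS -/F.
  set N1 : R := N.+1%:R in H0 *; have N0 : 0 < N1 by rewrite ltr0n.
  have D0 : 0 < N1 + a by rewrite addr_gt0.
  by field; rewrite nat1r -/N1 !gt_eqF.
(* F is a sum of N.+1 terms at most B, and a < 1 *)
have num : `|g i - a * (F / N.+1%:R)| <= 2 * B.
  apply: le_trans (ler_normB _ _) _; rewrite mulr_natl mulr2n lerD//.
  rewrite normrM (gtr0_norm a_gt0) -[leRHS]mul1r ler_pM ?(ltW a_gt0) ?(ltW a_lt1)//.
  by rewrite normf_div normr_nat ler_pdivrMr ?ltr0n// mulrC.
have c0 : 0 < 2 * a - 1 by rewrite subr_gt0.
have c1 : 2 * a - 1 < 1 by rewrite ltrBlDr -[1 + 1]mulr1 ltr_pM2l.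
have Nc0 : (0 : R) < N.+2%:R by rewrite ltr0n.
rewrite -(real_normK (num_real _)) normrM (gtr0_norm (x := _^-1)) ?invr_gt0//.
rewrite expr_div_n.
apply: (@le_trans _ _ ((2 * B) ^+ 2 / (N.+2%:R `^ (2 * a - 1) * N.+2%:R))).
  rewrite ler_pM ?invr_ge0 ?sqr_ge0//.
    by rewrite ler_pXn2r ?nnegrE ?mulr_ge0.
  rewrite lef_pV2 ?posrE ?exprn_gt0 ?mulr_gt0 ?powR_gt0//.
  rewrite -[X in _ * X]powRr1 ?(ltW Nc0)// -powRD; last by apply/implyP => _; rewrite gt_eqF.
  rewrite subrK mulrC powRrM powR_mulrn ?powR_ge0//.
  by rewrite ler_pXn2r ?nnegrE ?powR_ge0 ?(ltW G1)// growth_ge.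
rewrite /potential -mulrBr exprMn -natrX.
apply: le_trans (ler_wpM2l _ (powR_diff_ge c0 c1 (ltn0Sn N))); last first.
  exact: divr_ge0 (mulr_ge0 (ler0n _ 4) (sqr_ge0 B)) (ltW c0).
by rewrite [leRHS]mulrA divfK ?gt_eqF.
Qed.

End ElephantKernel.

(** * Step processes as chains, and independent pairs of chains *)

Section StepChain.
Context {R : realType} {d m : nat} {dO : measure_display}.
Context {Omega : measurableType dO} (P : probability Omega R).
Variables (v : 'I_m -> 'rV[R]_d) (p : R) (i0 : 'I_m).
Variables (s : nat -> Omega -> 'rV[R]_d) (U : forall n : nat, Omega -> 'I_n.+1).
Hypothesis v_inj : injective v.
Hypothesis s_step : step_process P v p i0 s U.

Definition step_index (n : nat) (w : Omega) : 'I_m :=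
  xget i0 [set i | s n w = v i].

Lemma step_indexE n w : s n w = v (step_index n w).
Proof.
have [[sv _ _] _ _ _ _] := s_step; have [i _ vi] := sv n w.
by apply: (xgetPex i0 (P := [set i | s n w = v i])); exists i.
Qed.

Lemma preimage_step_index n i :
  step_index n @^-1` [set i] = s n @^-1` [set v i].
Proof.
apply/seteqP; split => w /=; rewrite step_indexE; first by move=> ->.
exact: v_inj.
Qed.

Let pastE n (T : seq 'I_m) : size T = n.+1 ->
  history step_index n.+1 @^-1` [set T] = past s v (fun k : 'I_n.+1 => nth i0 T k).
Proof.
move=> sT; apply/seteqP; split => w /=.
  by move=> <- k; rewrite step_indexE (nth_map 0%N) ?size_iota// nth_iota.
move=> H; apply: (@eq_from_nth _ i0); rewrite size_history ?sT// => k kn.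
rewrite (nth_map 0%N) ?size_iota// nth_iota// add0n.
by apply: v_inj; rewrite -step_indexE (H (Ordinal kn)).
Qed.

(** Averaging the conditional law of the next step over the uniform selector
    gives the kernel, in which the remembered step is a uniform entry of the
    history. *)
Lemma step_index_chain : chain P (erw_kernel p) i0 step_index.
Proof.
have [[_ ms mU] s0 PU sU sT] := s_step.
have mI n i : measurable (step_index n @^-1` [set i]).
  by rewrite preimage_step_index.
split=> // [w|T i T0]; first by apply: v_inj; rewrite -step_indexE s0.
have [n nT] : exists n, size T = n.+1 by exists (size T).-1; rewrite prednK.
pose h := (fun k : 'I_n.+1 => nth i0 T k).
have mpast : measurable (past s v h).
  by rewrite -(pastE nT); exact: measurable_history.
rewrite nT (pastE nT).
rewrite (_ : _ @^-1` _ = \bigcup_(k in [set: 'I_n.+1])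
   (past s v h `&` U n @^-1` [set k] `&` s n.+1 @^-1` [set v i])); last first.
  apply/seteqP; split => w /=.
    rewrite historyS => /rcons_inj[HT Hi].
    exists (U n w) => //; split; last by rewrite /= step_indexE Hi.
    by split => //; rewrite -/h -(pastE nT).
  move=> [k _ [[Hp _] /= Hi]]; move: Hp; rewrite -(pastE nT) /= => Hp.
  by rewrite historyS Hp; congr rcons; apply: v_inj; rewrite -step_indexE.
rewrite measure_bigcup_finType; last 2 first.
- by move=> k; apply: measurableI => //; apply: measurableI.
- by move=> k l _ _ [w /= [[[_ <-] _] [[_ <-] _]]].
have Pfin : P (past s v h) \is a fin_num by exact: fin_num_measure.
rewrite (eq_bigr (fun k =>
    (fine (P (past s v h)) * n.+1%:R^-1 * step_prob p i (h k))%:E)); last first.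
  by move=> k _; rewrite [LHS]sT sU PU -(fineK Pfin) -!EFinM.
rewrite -(fineK Pfin) -EFinM sumEFin; congr EFin; rewrite /erw_kernel.
rewrite nT (big_nth i0) nT big_mkord mulrA mulr_sumr.
by apply: eq_bigr.
Qed.

Lemma history_process_sigma n (A : set (seq 'I_m)) :
  process_sigma_algebra s U (history step_index n @^-1` A).
Proof.
rewrite /process_sigma_algebra; set G := (X in <<s X >>).
apply: (@measurable_history _ (g_sigma_algebraType G) _ step_index).
move=> k i; rewrite preimage_step_index.
by apply: sub_sigma_algebra; left; exists k, (v i).
Qed.

End StepChain.

Section ProductChain.
Context {R : realType} {X Y : finType} {dO : measure_display}.
Context {Omega : measurableType dO} (P : probability Omega R).

Definition prod_kernel (K : seq X -> X -> R) (L : seq Y -> Y -> R)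
    (T : seq (X * Y)) (z : X * Y) : R :=
  K (unzip1 T) z.1 * L (unzip2 T) z.2.

Variables (K : seq X -> X -> R) (L : seq Y -> Y -> R).

Lemma sum_prod_kernel (f : X -> R) (g : Y -> R) T :
  \sum_z prod_kernel K L T z * (f z.1 * g z.2) =
  (\sum_x K (unzip1 T) x * f x) * (\sum_y L (unzip2 T) y * g y).
Proof.
rewrite big_distrlr /= pair_big /=; apply: eq_bigr => z _.
by rewrite /prod_kernel mulrACA.
Qed.

Hypotheses (K_kernel : transition_kernel K) (L_kernel : transition_kernel L).

Lemma prod_kernel_transition : transition_kernel (prod_kernel K L).
Proof.
have [K0 K1] := K_kernel; have [L0 L1] := L_kernel.
split=> [T z|T T0]; first by rewrite mulr_ge0.
have := sum_prod_kernel (fun=> 1) (fun=> 1) T.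
under [X in X = _]eq_bigr do rewrite !mulr1.
under [X in X * _]eq_bigr do rewrite mulr1.
under [X in _ * X]eq_bigr do rewrite mulr1.
by rewrite K1 ?L1 ?size_map// mulr1.
Qed.

(** Each summand is a martingale for its own factor, and the other factor of the
    kernel sums to 1. *)
Lemma prod_kernel_martingale M N : martingale K M -> martingale L N ->
  martingale (prod_kernel K L) (fun T => M (unzip1 T) + N (unzip2 T)).
Proof.
have [K0 K1] := K_kernel; have [L0 L1] := L_kernel.
move=> HM HN T T0.
have uT : (0 < size (unzip1 T))%N /\ (0 < size (unzip2 T))%N by rewrite !size_map.
have := sum_prod_kernel (fun x => M (rcons (unzip1 T) x)) (fun=> 1) T.
have := sum_prod_kernel (fun=> 1) (fun y => N (rcons (unzip2 T) y)) T.
have -> : \sum_x K (unzip1 T) x * 1 = 1.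
  by under eq_bigr do rewrite mulr1; apply: K1; case: uT.
have -> : \sum_y L (unzip2 T) y * 1 = 1.
  by under eq_bigr do rewrite mulr1; apply: L1; case: uT.
rewrite mulr1 mul1r HM ?HN; try by case: uT.
move=> <- <-; rewrite -big_split /=; apply: eq_bigr => z _.
by rewrite /unzip1 /unzip2 !map_rcons mul1r mulr1 mulrDr.
Qed.

Variables (x0 : X) (y0 : Y) (xi : nat -> Omega -> X) (eta : nat -> Omega -> Y).

Lemma unzip1_history n w :
  unzip1 (history (fun k w => (xi k w, eta k w)) n w) = history xi n w.
Proof. by rewrite /unzip1 -map_comp. Qed.

Lemma unzip2_history n w :
  unzip2 (history (fun k w => (xi k w, eta k w)) n w) = history eta n w.
Proof. by rewrite /unzip2 -map_comp. Qed.

Hypotheses (xi_chain : chain P K x0 xi) (eta_chain : chain P L y0 eta).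
Hypothesis indep : forall n n' (A : set (seq X)) (B : set (seq Y)),
  P (history xi n @^-1` A `&` history eta n' @^-1` B) =
  (P (history xi n @^-1` A) * P (history eta n' @^-1` B))%E.

Lemma history_pairE n T :
  history (fun k w => (xi k w, eta k w)) n @^-1` [set T] =
  history xi n @^-1` [set unzip1 T] `&` history eta n @^-1` [set unzip2 T].
Proof.
apply/seteqP; split => w /=.
  by move=> <-; rewrite unzip1_history unzip2_history.
rewrite -(unzip1_history n w) -(unzip2_history n w) => -[H1 H2].
by rewrite -(zip_unzip T) -H1 -H2 zip_unzip.
Qed.

(** Independence of the two histories at a fixed time suffices: the law of a
    pair of histories factorises, and so do its one-step ratios. *)
Lemma product_chain :
  chain P (prod_kernel K L) (x0, y0) (fun k w => (xi k w, eta k w)).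
Proof.
have [mx x00 xT] := xi_chain; have [my y00 yT] := eta_chain.
split=> [n [x y]|w|T [x y] T0].
- rewrite (_ : _ @^-1` _ = xi n @^-1` [set x] `&` eta n @^-1` [set y]).
    exact: measurableI.
  by apply/seteqP; split => w /= [-> ->].
- by rewrite x00 y00.
rewrite !history_pairE !indep /unzip1 /unzip2 !map_rcons /=.
have HX := xT (unzip1 T) x; have HY := yT (unzip2 T) y.
rewrite !size_map in HX HY.
rewrite HX// HY// /prod_kernel EFinM.
by rewrite muleACA.
Qed.

End ProductChain.

(** * From asymptotics of the walk to Skorokhod convergence *)

Section Skorokhod.
Context {R : realType} {d : nat}.
Implicit Types (f g : R -> 'rV[R]_d) (a : R).

Lemma continuous_cadlag f : (forall t : R, 0 <= t -> {for t, continuous f}) ->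
  cadlag f.
Proof.
move=> cf; split=> t t0; first exact/cvg_at_right_filter/cf.
by apply/cvg_ex; exists (f t); exact/cvg_at_left_filter/cf/ltW.
Qed.

Lemma cadlagB f g : cadlag f -> cadlag g -> cadlag (fun t => f t - g t).
Proof.
move=> [fr fl] [gr gl]; split=> t t0; first by apply: cvgB; [exact: fr|exact: gr].
by apply: is_cvgB; [exact: fl|exact: gl].
Qed.

Lemma cadlagZ (k : R) f : cadlag f -> cadlag (fun t => k *: f t).
Proof.
move=> [fr fl]; split=> t t0; first by apply: cvgZr; exact: fr.
by apply: is_cvgZr; exact: fl.
Qed.

(** The truncation is right-continuous because its level sets are of the form
    [k, k + 1); to the left of t it takes the value k with k < b t <= k + 1. *)
Lemma cadlag_truncn (h : nat -> 'rV[R]_d) (b : R) : 0 <= b ->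
  cadlag (fun t => h (Num.truncn (b * t))).
Proof.
rewrite le_eqVlt => /predU1P[<-|b0].
  rewrite (_ : (fun _ => _) = cst (h (Num.truncn (0 : R)))); last first.
    by apply/funext => t; rewrite mul0r.
  by apply: continuous_cadlag => t _; exact: cvg_cst.
split=> t t0.
  have /andP[tl tu] := truncn_itv (mulr_ge0 (ltW b0) t0).
  apply: cvg_near_cst; near=> x; congr h; apply: truncn_def.
  apply/andP; split.
    rewrite (le_trans tl)// ler_pM2l// ltW//; near: x; exact: nbhs_right_gt.
  rewrite mulrC -ltr_pdivlMr//; near: x; apply: nbhs_right_lt.
  by rewrite ltr_pdivlMr// mulrC.
have [k /andP[kl ku]] : exists k : nat, k%:R < b * t <= k.+1%:R.
  have bt0 : 0 < b * t by rewrite mulr_gt0.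
  have /andP[tl tu] := truncn_itv (ltW bt0).
  move: tl; rewrite le_eqVlt => /predU1P[tE|tl]; last first.
    by exists (Num.truncn (b * t)); rewrite tl ltW.
  move: tE tu; case: (Num.truncn _) => [tE|k <- _].
    by rewrite -tE ltxx in bt0.
  by exists k; rewrite ltr_nat ltnSn lexx.
apply/cvg_ex; exists (h k); apply: cvg_near_cst; near=> x; congr h; apply: truncn_def.
apply/andP; split.
  rewrite mulrC -ler_pdivrMr// ltW//; near: x; apply: nbhs_left_gt.
  by rewrite ltr_pdivrMr// mulrC.
rewrite (lt_le_trans _ ku)// ltr_pM2l//; near: x; exact: nbhs_left_lt.
Unshelve. all: by end_near. Qed.

Lemma cadlag_powR a (l : 'rV[R]_d) : 0 < a -> cadlag (fun t => t `^ a *: l).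
Proof.
move=> a0; have cpos t : 0 < t -> {for t, continuous (fun t : R => t `^ a)}.
  move=> t0; apply: differentiable_continuous; apply/derivable1_diffP.
  by apply: derivable_powR; rewrite in_itv/= andbT.
split=> t; last first.
  move=> t0; apply/cvg_ex; exists (t `^ a *: l); apply: cvgZl.
  exact/cvg_at_left_filter/cpos.
rewrite le_eqVlt => /predU1P[<-|t0]; apply: cvgZl.
  by rewrite powR0 ?gt_eqF//; exact: powR_cvg0.
exact/cvg_at_right_filter/cpos.
Qed.

Lemma uniform_cvgP (A : set R) (f_ : nat -> R -> 'rV[R]_d) f :
  (forall e : R, 0 < e ->
    \forall n \near \oo, forall t, A t -> `|f t - f_ n t| < e) ->
  {uniform A, f_ @ \oo --> f}.
Proof.
move=> H S /uniform_nbhs[E [/= entE ES]].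
move: entE; rewrite -entourage_ballE => -[e /= e0 eE].
apply: filterS (H e e0) => n Hn; apply: ES => t At; apply: eE => /=.
by rewrite -ball_normE /=; exact: Hn.
Qed.

Lemma time_change_id : time_change (id : R -> R).
Proof.
split=> //; first by apply: continuous_subspaceT => t; exact: cvg_id.
by rewrite image_id.
Qed.

(** For k >= 1 and y in [k, k + 1), y^a <= k^a (1 + 1/k)^a
    <= k^a + a k^(a-1) <= k^a + 1. *)
Lemma powR_truncn a (y : R) : 0 < a -> a < 1 -> 0 <= y ->
  0 <= y `^ a - (Num.truncn y)%:R `^ a <= 1.
Proof.
move=> a0 a1 y0; have /andP[] := truncn_itv y0; set k := Num.truncn y => ky yk.
rewrite subr_ge0 ge0_ler_powR ?nnegrE ?(ltW a0)//= lerBlDl.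
apply: (@le_trans _ _ (k.+1%:R `^ a)).
  by rewrite ge0_ler_powR ?nnegrE ?ler0n ?(ltW a0) ?(ltW yk).
case: (k) => [|n]; first by rewrite powR1 lerDr powR_ge0.
have N0 : (0 : R) < n.+1%:R by rewrite ltr0n.
have -> : n.+2%:R = n.+1%:R * (1 + n.+1%:R^-1) :> R.
  by rewrite mulrDr mulr1 mulfV ?pnatr_eq0// natr1.
rewrite powRM ?addr_ge0 ?invr_ge0 ?(ltW N0)//.
apply: (@le_trans _ _ (n.+1%:R `^ a * (1 + a * n.+1%:R^-1))).
  rewrite ler_wpM2l ?powR_ge0//; apply: powR_bernoulli => //.
  by rewrite (le_trans (lerN10 _))// invr_ge0 ltW.
rewrite mulrDr mulr1 lerD2l mulrA ler_pdivrMr// mul1r.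
rewrite (le_trans (ler_piMr (powR_ge0 _ _) (ltW a1)))//.
by rewrite ler1_powR ?ler1n ?ltW.
Qed.

(** Here g k is the centred walk after k rounds of steps and h the walk itself,
    with b steps in a round; c bounds the effect of an unfinished round. The
    error eps y^a + C at y = n r becomes eps r^a + C n^-a after division by n^a,
    which is uniformly small for r in [0, T]. *)
Lemma skorokhod_of_linear_correction a b (h g : nat -> 'rV[R]_d) (z l : 'rV[R]_d)
    (c : R) : 0 < a -> a < 1 -> 0 <= b ->
  (n%:R `^ a)^-1 *: g n @[n --> \oo] --> l ->
  (forall y, 0 <= y ->
    `|h (Num.truncn (b * y)) - y *: z - g (Num.truncn y)| <= c) ->
  skorokhod_cvg
    (fun n r => (n%:R `^ a)^-1 *:
       (h (Num.truncn (b * n%:R * r)) - (n%:R * r) *: z))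
    (fun r => r `^ a *: l).
Proof.
move=> a0 a1 b0 gl hg.
have c_ge0 : 0 <= c by apply: le_trans (hg 0 (lexx 0)).
(* large k by convergence; the finitely many others go into the constant C *)
have gk e : 0 < e -> exists2 C : R, 0 <= C &
    forall k : nat, `|g k - k%:R `^ a *: l| <= e * k%:R `^ a + C.
  move=> e0; have /cvgrPdist_lt/(_ _ e0)[N _ HN] := gl.
  exists (\sum_(k < N.+1) `|g k - k%:R `^ a *: l|); first exact: sumr_ge0.
  move=> k; have [kN|Nk] := leqP k N.
    rewrite (bigD1 (Ordinal (kN : (k < N.+1)%N)))//= addrCA lerDl.
    by rewrite addr_ge0 ?mulr_ge0 ?powR_ge0 ?(ltW e0)// sumr_ge0.
  have ka0 : 0 < k%:R `^ a by rewrite powR_gt0// ltr0n (leq_trans _ Nk).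
  rewrite (@le_trans _ _ (e * k%:R `^ a)) ?lerDl ?sumr_ge0//.
  have -> : g k - k%:R `^ a *: l = k%:R `^ a *: - (l - (k%:R `^ a)^-1 *: g k).
    by rewrite opprB scalerBr scalerA mulfV ?gt_eqF// scale1r.
  rewrite normrZ normrN gtr0_norm// mulrC ler_pM2r// ltW// HN//=.
  exact: ltnW.
have Dk e : 0 < e -> exists2 C : R, 0 <= C & forall y, 0 <= y ->
    `|y `^ a *: l - (h (Num.truncn (b * y)) - y *: z)| <= e * y `^ a + C.
  move=> /[dup] e0 /gk[C C0 gC]; exists (C + c + `|l|).
    by rewrite !addr_ge0.
  move=> y y0; have /andP[p0 p1] := powR_truncn a0 a1 y0.
  have := hg y y0; have := gC (Num.truncn y).
  set H := h _ - _; set k := Num.truncn y in p0 p1 * => gk_ Hg.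
  have -> : y `^ a *: l - H =
      (y `^ a - k%:R `^ a) *: l - (g k - k%:R `^ a *: l) - (H - g k).
    by rewrite scalerBl (opprB (g k)) (opprB H) !subrKA.
  have n1 : `|(y `^ a - k%:R `^ a) *: l| <= `|l|.
    by rewrite normrZ ger0_norm// ler_piMl.
  have n2 : e * k%:R `^ a <= e * y `^ a by rewrite ler_pM2l// -subr_ge0.
  apply: le_trans (ler_normB _ _) _; apply: le_trans (lerD (ler_normB _ _) (lexx _)) _.
  lra.
split.
- move=> n; apply/cadlagZ/cadlagB.
    by apply: cadlag_truncn; rewrite mulr_ge0.
  apply: continuous_cadlag => t _.
  by apply: cvgZl; apply: cvgMr; exact: cvg_id.
- exact: cadlag_powR.
exists (fun=> id); split; first by move=> _; exact: time_change_id.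
  move=> S /uniform_nbhs[E [entE ES]]; exists 0%N => // n _; apply: ES => t _.
  exact: entourage_refl.
move=> T T0; apply: uniform_cvgP => e e0.
pose e1 := e / 2 / (T `^ a + 1).
have Ta : 0 < T `^ a + 1 by rewrite ltr_wpDl ?powR_ge0.
have e10 : 0 < e1 by rewrite !divr_gt0.
have [C C0 DC] := Dk _ e10.
have Ce : 0 < e / 2 / (C + 1) by rewrite !divr_gt0// ltr_wpDl.
have /cvgr0Pnorm_lt/(_ _ Ce) := powR_natV_cvg0 (R := R) a0.
move=> near_n; near=> n => t; rewrite /= in_itv/= => /andP[t0 tT].
have n0 : 0 < n%:R `^ a :> R.
  by rewrite powR_gt0// ltr0n; near: n; exact: nbhs_infty_gt.
have nC : (n%:R `^ a)^-1 * (C + 1) < e / 2.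
  have nn : `|(n%:R `^ a)^-1| < e / 2 / (C + 1) by near: n.
  rewrite -ltr_pdivlMr ?ltr_wpDl//; apply: le_lt_trans nn; exact: ler_norm.
have -> : t `^ a *: l - (n%:R `^ a)^-1 *:
     (h (Num.truncn (b * n%:R * t)) - (n%:R * t) *: z) =
   (n%:R `^ a)^-1 *: ((n%:R * t) `^ a *: l -
     (h (Num.truncn (b * (n%:R * t))) - (n%:R * t) *: z)).
  rewrite [RHS]scalerBr scalerA powRM// mulrA mulVf ?gt_eqF// mul1r.
  by rewrite mulrA.
rewrite normrZ gtr0_norm ?invr_gt0//.
apply: (@le_lt_trans _ _ ((n%:R `^ a)^-1 * (e1 * (n%:R * t) `^ a + C))).
  by rewrite ler_pM2l ?invr_gt0// DC// mulr_ge0.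
rewrite mulrDr powRM// mulrCA mulKf ?gt_eqF//.
rewrite [e]splitr ler_ltD//.
  apply: (@le_trans _ _ (e1 * (T `^ a + 1))); last by rewrite /e1 divfK ?gt_eqF.
  rewrite ler_pM2l// (@le_trans _ _ (T `^ a)) ?lerDl//.
  by rewrite ge0_ler_powR ?nnegrE ?(ltW a0).
apply: le_lt_trans nC; rewrite ler_pM2l ?invr_gt0// lerDl//.
Unshelve. all: by end_near. Qed.

End Skorokhod.

(** * The limiting random vector *)

(** Off a null set N the limit lies in an open set O exactly when, for some k,
    the balls of radius 1/(k+1) around Z n are eventually included in O. This
    is a countable combination of events of the Z n. *)
Lemma random_vector_limit {R : realType} {d : nat} {dO : measure_display}
    {Omega : measurableType dO} (P : probability Omega R)
    (Z : nat -> Omega -> 'rV[R]_d) :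
  (forall n A, measurable (Z n @^-1` A)) ->
  {ae P, forall w, cvg (Z n w @[n --> \oo])} ->
  exists2 L : Omega -> 'rV[R]_d, random_vector L &
    {ae P, forall w, Z n w @[n --> \oo] --> L w}.
Proof.
move=> mZ [N [mN N0 cvN]].
have cvZ w : ~ N w -> cvg (Z n w @[n --> \oo]).
  by move=> Nw; apply: contrapT => ncv; apply/Nw/cvN.
pose L w := if pselect (N w) then 0 else lim (Z n w @[n --> \oo]).
have LN w : N w -> L w = 0 by rewrite /L; case: (pselect (N w)).
have LC w : ~ N w -> Z n w @[n --> \oo] --> L w.
  by rewrite /L; case: (pselect (N w)) => // nNw _; exact: cvZ.
exists L; last first.
  exists N; split=> // w nL; apply: contrapT => Nw; apply: nL; exact: LC.
move=> O oO.
pose F k := [set y : 'rV[R]_d | ball y k.+1%:R^-1 `<=` O].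
have -> : L @^-1` O =
    (~` N `&` \bigcup_k \bigcup_K \bigcap_(n in [set n | (K <= n)%N]) (Z n @^-1` F k))
    `|` (N `&` [set w | O 0]).
  apply/seteqP; split=> w /=.
    move=> OL; have [Nw|Nw] := pselect (N w); first by right; rewrite -(LN w).
    left; split => //.
    have /nbhs_ballP[e /= e0 eO] : nbhs (L w) O by exact: open_nbhs_nbhs.
    have e20 : 0 < e / 2 by rewrite divr_gt0.
    have [k _ /(_ k (leqnn k)) /= ke] := near_infty_natSinv_lt (PosNum e20).
    have /cvg_ball/(_ _ e20)[K _ HK] := LC w Nw.
    exists k => //; exists K => // n /= Kn y yB; apply: eO.
    rewrite (splitr e); apply: ball_triangle (HK n Kn) _.
    exact: le_ball (ltW ke) _ yB.
  move=> [[Nw [k _ [K _ KF]]]|[Nw hO]]; last by rewrite (LN w).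
  have k0 : (0 : R) < k.+1%:R^-1 by rewrite invr_gt0.
  have /cvg_ball/(_ _ k0)[K' _ HK] := LC w Nw.
  apply: (KF (maxn K K')); rewrite /= ?leq_maxl//.
  by apply/ball_sym/HK; rewrite /= leq_maxr.
apply: measurableU.
  apply: measurableI; first exact: measurableC.
  apply: bigcupT_measurable => k; apply: bigcupT_measurable => K.
  by apply: bigcap_measurable => [|n _]; [exists K => /=|exact: mZ].
apply: measurableI => //.
have [hO|hO] := pselect (O 0).
  by rewrite (_ : [set w | _] = setT)//; apply/seteqP; split.
by rewrite (_ : [set w | _] = set0)//; apply/seteqP; split.
Qed.

Section Deviation.
Context {R : realType} {d m : nat}.
Variable v : 'I_m -> 'rV[R]_d.

Definition deviation (T : seq 'I_m) : 'rV[R]_d := \sum_(j <- T) (v j - vmean v).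

Definition coord_dev (c : 'I_d) (j : 'I_m) : R := (v j - vmean v) 0 c.

Lemma deviation_coord c T : deviation T 0 c = \sum_(j <- T) coord_dev c j.
Proof. by rewrite /deviation summxE. Qed.

Lemma coord_dev_sum0 c : (0 < m)%N -> \sum_j coord_dev c j = 0.
Proof.
move=> m0; rewrite -summxE sumrB sumr_const card_ord /vmean.
by rewrite -scaler_nat scalerA mulfV ?pnatr_eq0 -?lt0n// scale1r subrr mxE.
Qed.

Lemma coord_dev_bound : exists B : R, forall c j, `|coord_dev c j| <= B.
Proof.
exists (\sum_c \sum_j `|coord_dev c j|) => c j.
rewrite (bigD1 c)//= (bigD1 j)//= -addrA lerDl addr_ge0// sumr_ge0// => k _.
by rewrite sumr_ge0.
Qed.

Lemma injective_coord_neq : injective v -> (1 < m)%N ->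
  exists (c : 'I_d) (i j : 'I_m), coord_dev c i != coord_dev c j.
Proof.
move=> v_inj m1; apply: contrapT => eqv.
have /v_inj/(congr1 val) : v (Ordinal (ltnW m1)) = v (Ordinal m1).
  apply: (addIr (- vmean v)); apply/rowP => c; apply/eqP/negPn/negP => ne.
  by apply: eqv; exists c, (Ordinal (ltnW m1)), (Ordinal m1).
by [].
Qed.

End Deviation.

Section ChainDeviation.
Context {R : realType} {d m : nat} {dO : measure_display}.
Context {Omega : measurableType dO} (P : probability Omega R).
Variables (v : 'I_m -> 'rV[R]_d) (p a : R).
Hypotheses (m_gt1 : (1 < m)%N) (p_gt0 : 0 < p) (p_lt1 : p < 1).
Hypothesis aE : a = (m%:R * p - 1) / (m%:R - 1).
Hypotheses (a_gt : 1 < 2 * a) (a_lt1 : a < 1).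

Let a_gt0 : 0 < a.
Proof. by rewrite -(@pmulr_rgt0 _ 2) ?ltr0n// (lt_trans ltr01). Qed.

Lemma coord_mart c : martingale (erw_kernel p) (erw_mart a (coord_dev v c)).
Proof.
by apply: erw_mart_martingale => //; apply: coord_dev_sum0; exact: ltnW.
Qed.

Lemma coord_mart_potential : exists V : nat -> R,
  [/\ forall n, 0 <= V n, V @ \oo --> 0 &
  forall c T i, (0 < size T)%N ->
    (erw_mart a (coord_dev v c) (rcons T i) - erw_mart a (coord_dev v c) T) ^+ 2
    <= V (size T) - V (size T).+1].
Proof.
have [B HB] := coord_dev_bound v; exists (potential a B); split.
- by move=> n; exact: potential_ge0.
- exact: potential_cvg0.
- by move=> c T i T0; apply: erw_mart_incr => // j; exact: HB.
Qed.

Lemma growth_ratio_cvg : exists2 gam : R, 0 < gam &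
  growth a n.-1 / n%:R `^ a @[n --> \oo] --> gam.
Proof.
have [gam g0 gcv] := growth_equiv a_gt0 a_lt1; exists gam => //.
by rewrite -cvg_shiftS.
Qed.

(** Coordinatewise, the deviation is its martingale times the growth, and
    growth over n^a converges. *)
Lemma chain_deviation_cvg (i0 : 'I_m) (xi : nat -> Omega -> 'I_m) :
  chain P (erw_kernel p) i0 xi ->
  {ae P, forall w,
    cvg ((n%:R `^ a)^-1 *: deviation v (history xi n w) @[n --> \oo])}.
Proof.
move=> xi_chain; have [V [V0 Vcv HV]] := coord_mart_potential.
have [gam g0 gcv] := growth_ratio_cvg.
have ae_c (c : 'I_d) : {ae P, forall w,
    cvg (erw_mart a (coord_dev v c) (history xi n w) @[n --> \oo])}.
  apply: (martingale_ae_cvg (erw_kernel_transition m_gt1 p_gt0 p_lt1) xi_chain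
    (coord_mart c) V0 Vcv) => T i.
  exact: HV.
have : {ae P, forall w, forall c,
    cvg (erw_mart a (coord_dev v c) (history xi n w) @[n --> \oo])}.
  exact: filter_forall.
apply: filterS => w cvw.
rewrite (_ : (fun n => _) = fun n => \sum_c ((growth a n.-1 / n%:R `^ a) *
   erw_mart a (coord_dev v c) (history xi n w)) *: delta_mx 0 c); last first.
  apply/funext => n; rewrite [LHS]row_sum_delta; apply: eq_bigr => c _.
  congr (_ *: _); rewrite mxE deviation_coord /erw_mart size_history.
  by rewrite [RHS]mulrC -[RHS]mulrA mulKf ?gt_eqF ?growth_gt0// mulrC.
apply: (cvgP (\sum_c (gam * lim (erw_mart a (coord_dev v c) (history xi n w)
   @[n --> \oo])) *: delta_mx 0 c)).
apply: cvg_big => [|c _]; first exact: add_continuous.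
by apply: cvgZl; apply: cvgM => //; exact: cvw.
Qed.

(** Passing from the normalisation n^a back to that of the martingale. *)
Lemma coord_renormalise (D : nat -> 'rV[R]_d) c :
  (n%:R `^ a)^-1 *: D n @[n --> \oo] --> (0 : 'rV[R]_d) ->
  D n 0 c / growth a n.-1 @[n --> \oo] --> 0.
Proof.
move=> D0; have [gam g0 gcv] := growth_ratio_cvg.
have coord0 : ((n%:R `^ a)^-1 *: D n) 0 c @[n --> \oo] --> 0.
  have H : N 0 c @[N --> (0 : 'rV[R]_d)] --> (0 : 'rV[R]_d) 0 c.
    exact: (@coord_continuous R 1 d 0 c).
  by rewrite mxE in H; exact: cvg_comp D0 H.
have H : (growth a n.-1 / n%:R `^ a)^-1 * ((n%:R `^ a)^-1 *: D n) 0 c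
    @[n --> \oo] --> 0.
  rewrite -[X in _ --> X](mulr0 gam^-1); apply: cvgM coord0.
  by apply: cvgV gcv; rewrite gt_eqF.
apply: cvg_trans H; apply: near_eq_cvg; near=> n.
have n0 : 0 < n%:R `^ a :> R.
  by rewrite powR_gt0// ltr0n; near: n; exact: nbhs_infty_gt.
rewrite mxE /=.
by field; rewrite !gt_eqF// growth_gt0.
Unshelve. all: by end_near. Qed.

Lemma erw_mart_two f (i j : 'I_m) :
  erw_mart a f [:: i; j] = (f i + f j) / growth a 1.
Proof. by rewrite /erw_mart !big_cons big_nil addr0. Qed.

(** Otherwise each coordinate martingale vanishes at every history (i0, k), which
    has positive probability; so g(i0) + g(k) = 0 for all k, and all steps have
    the same coordinates. *)
Lemma chain_deviation_ncvg0 (i0 : 'I_m) (xi : nat -> Omega -> 'I_m) :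
  injective v -> chain P (erw_kernel p) i0 xi ->
  ~ {ae P, forall w,
      (n%:R `^ a)^-1 *: deviation v (history xi n w) @[n --> \oo]
        --> (0 : 'rV[R]_d)}.
Proof.
move=> v_inj xi_chain Z0; have [V [V0 Vcv HV]] := coord_mart_potential.
have K_kernel := erw_kernel_transition m_gt1 p_gt0 p_lt1.
have [c [i [j /eqP[]]]] := injective_coord_neq v_inj m_gt1.
have sum0 k : coord_dev v c i0 + coord_dev v c k = 0.
  have := @martingale_ae_eq0 _ _ _ _ P _ _ _ K_kernel xi_chain _ V (coord_mart c)
    V0 (HV c) [:: i0; k] erefl.
  rewrite (chain_two_steps _ xi_chain)// eqe gt_eqF ?erw_kernel_gt0//.
  move=> /(_ isT); rewrite erw_mart_two => H.
  apply/eqP; rewrite -(mulIr_eq0 _ (x := (growth a 1)^-1)).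
    apply/eqP/H; apply: filterS Z0 => w /(coord_renormalise c) H0.
    apply: cvg_trans H0; apply: near_eq_cvg; apply: nearW => n.
    by rewrite /erw_mart size_history deviation_coord.
  by apply/mulIf; rewrite invr_neq0 ?gt_eqF ?growth_gt0.
by apply: (addrI (coord_dev v c i0)); rewrite !sum0.
Qed.

End ChainDeviation.

(** * The two walks together *)

Section PairDeviation.
Context {R : realType} {d m m' : nat} {dO : measure_display}.
Context {Omega : measurableType dO} (P : probability Omega R).
Variables (u : 'I_m -> 'rV[R]_d) (w : 'I_m' -> 'rV[R]_d) (p a : R).
Hypotheses (m_gt1 : (1 < m)%N) (m'_gt1 : (1 < m')%N).
Hypotheses (p_gt0 : 0 < p) (p_lt1 : p < 1).
Hypothesis aE : a = (m%:R * p - 1) / (m%:R - 1).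
Hypothesis aE' : a = (m'%:R * p - 1) / (m'%:R - 1).
Hypotheses (a_gt : 1 < 2 * a) (a_lt1 : a < 1).

(** As for one walk, at the histories (i0, j0), (k, j0): keeping the second walk
    fixed makes its contribution constant in k. *)
Lemma pair_deviation_ncvg0 (i0 : 'I_m) (j0 : 'I_m')
    (xi : nat -> Omega -> 'I_m) (eta : nat -> Omega -> 'I_m') :
  injective u -> chain P (erw_kernel p) i0 xi -> chain P (erw_kernel p) j0 eta ->
  (forall n n' (A : set (seq 'I_m)) (B : set (seq 'I_m')),
    P (history xi n @^-1` A `&` history eta n' @^-1` B) =
    (P (history xi n @^-1` A) * P (history eta n' @^-1` B))%E) ->
  ~ {ae P, forall x, (n%:R `^ a)^-1 *:
        (deviation u (history xi n x) + deviation w (history eta n x)) @[n --> \oo]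
        --> (0 : 'rV[R]_d)}.
Proof.
move=> u_inj xi_chain eta_chain indep Z0.
have a_gt0 : 0 < a by rewrite -(@pmulr_rgt0 _ 2) ?ltr0n// (lt_trans ltr01).
have [V1 [V10 V1cv HV1]] := coord_mart_potential u a_gt a_lt1.
have [V2 [V20 V2cv HV2]] := coord_mart_potential w a_gt a_lt1.
have K1 := @erw_kernel_transition R m p m_gt1 p_gt0 p_lt1.
have K2 := @erw_kernel_transition R m' p m'_gt1 p_gt0 p_lt1.
have [c [i [j /eqP[]]]] := injective_coord_neq u_inj m_gt1.
pose M T := erw_mart a (coord_dev u c) (unzip1 T)
          + erw_mart a (coord_dev w c) (unzip2 T).
have M_mart : martingale (prod_kernel (erw_kernel p) (erw_kernel p)) M.
  by apply: prod_kernel_martingale => //; apply: coord_mart.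
pose V n := 2 * V1 n + 2 * V2 n.
have V0 n : 0 <= V n by rewrite addr_ge0 ?mulr_ge0 ?ler0n.
have Vcv : V @ \oo --> 0.
  rewrite (_ : 0 = 2 * 0 + 2 * 0 :> R); last by rewrite mulr0 addr0.
  by apply: cvgD; apply: cvgMr.
have M_incr T x : (0 < size T)%N ->
    (M (rcons T x) - M T) ^+ 2 <= V (size T) - V (size T).+1.
  move=> T0; rewrite /M /unzip1 /unzip2 !map_rcons.
  have := HV1 c (unzip1 T) x.1; have := HV2 c (unzip2 T) x.2.
  rewrite !size_map => /(_ T0) h2 /(_ T0) h1.
  apply: le_trans
    (_ : 2 * (V1 (size T) - V1 (size T).+1) + 2 * (V2 (size T) - V2 (size T).+1) <= _).
    apply: le_trans (lerD (ler_wpM2l _ h1) (ler_wpM2l _ h2)) => //.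
    set A := erw_mart _ _ (rcons _ _); set B := erw_mart _ _ (unzip1 T).
    set C := erw_mart _ _ (rcons _ _); set D := erw_mart _ _ (unzip2 T).
    (* (x + y)^2 <= 2 x^2 + 2 y^2, as the difference is (x - y)^2 *)
    by have := sqr_ge0 ((A - B) - (C - D)); lra.
  by rewrite /V; lra.
have sum0 k : (coord_dev u c i0 + coord_dev u c k)
            + (coord_dev w c j0 + coord_dev w c j0) = 0.
  have C := product_chain xi_chain eta_chain indep.
  have := @martingale_ae_eq0 _ _ _ _ P _ _ _ (prod_kernel_transition K1 K2) C
    _ V M_mart V0 M_incr [:: (i0, j0); (k, j0)] erefl.
  rewrite (chain_two_steps (prod_kernel_transition K1 K2) C) eqe.
  rewrite gt_eqF => [/(_ isT)|]; last by apply: mulr_gt0; apply: erw_kernel_gt0.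
  rewrite /M !erw_mart_two -mulrDl => H.
  apply/eqP; rewrite -(mulIr_eq0 _ (x := (growth a 1)^-1)).
    apply/eqP/H; apply: filterS Z0 => x /(coord_renormalise a_gt a_lt1 c) H0.
    apply: cvg_trans H0; apply: near_eq_cvg; apply: nearW => n.
    rewrite /M unzip1_history unzip2_history /erw_mart !size_history.
    by rewrite mxE !deviation_coord mulrDl.
  by apply/mulIf; rewrite invr_neq0 ?gt_eqF ?growth_gt0.
apply: (addrI (coord_dev u c i0)).
by apply: (addIr (coord_dev w c j0 + coord_dev w c j0)); rewrite !sum0.
Qed.

End PairDeviation.

(** * The walks and the main theorem *)

Section WalkPaths.
Context {R : realType} {d : nat} {Omega : Type}.

Lemma walk_deviation {m : nat} (v : 'I_m -> 'rV[R]_d) (s : nat -> Omega -> 'rV[R]_d)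
    (xi : nat -> Omega -> 'I_m) n x : (forall n x, s n x = v (xi n x)) ->
  \sum_(i < n) s i x - n%:R *: vmean v = deviation v (history xi n x).
Proof.
move=> sE; rewrite /deviation big_map -[in RHS](subn0 n) big_mkord.
by rewrite sumrB sumr_const card_ord scaler_nat; congr (_ - _); apply: eq_bigr.
Qed.

Lemma regroup_differences (S1 S2 C1 C2 D e : 'rV[R]_d) :
  S1 + S2 + e - D - (S1 - C1 + (S2 - C2)) = C1 + C2 - D + e.
Proof. by apply/rowP => c; rewrite !mxE; ring. Qed.

Lemma truncn_double (y : R) : 0 <= y ->
  (Num.truncn (2 * y))./2 = Num.truncn y.
Proof.
move=> y0; have /andP[kl ku] := truncn_itv y0; set k := Num.truncn y in kl ku *.
have y20 : 0 <= 2 * y by rewrite mulr_ge0.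
have /andP[] : (k.*2 <= Num.truncn (2 * y) < k.*2.+2)%N.
  rewrite truncn_ge_nat// truncn_lt_nat// -doubleS -!mul2n !natrM.
  by rewrite ler_pM2l// ltr_pM2l// kl ku.
by move=> h1 h2; lia.
Qed.

Lemma norm_truncn_sub_le (y : R) (z : 'rV[R]_d) : 0 <= y ->
  `|(Num.truncn y)%:R *: z - y *: z| <= `|z|.
Proof.
move=> y0; have /andP[kl ku] := truncn_itv y0.
rewrite -scalerBl normrZ ler_piMl// distrC ger0_norm ?subr_ge0//.
by rewrite lerBlDl natr1 ltW.
Qed.

End WalkPaths.

(** 2a > 1 is the condition p > p_c solved for a, and a < 1 is p < 1. *)
Lemma memory_exponent_bounds {R : realType} (m : nat) (p a : R) :
  (1 < m)%N -> p < 1 -> a = (m%:R * p - 1) / (m%:R - 1) ->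
  critical_p R m < p -> 1 < 2 * a /\ a < 1.
Proof.
move=> m1 p1 aE pc; have m0 : (0 : R) < m%:R by rewrite ltr0n ltnW.
have m10 : 0 < m%:R - 1 :> R by rewrite subr_gt0 ltr1n.
move: pc; rewrite /critical_p ltr_pdivrMr ?mulr_gt0// => pc; split.
  by rewrite aE mulrA ltr_pdivlMr// mul1r; lra.
by rewrite aE ltr_pdivrMr// mul1r ltrD2r gtr_pMr.
Qed.

(** Since p_c = 1/2 + 1/(2m), equal thresholds force equal numbers of steps, hence
    equal exponents for the two step processes. *)
Lemma critical_p_inj {R : realType} (m m' : nat) : (0 < m)%N -> (0 < m')%N ->
  critical_p R m = critical_p R m' -> m = m'.
Proof.
move=> m0 m'0; have mR : (0 : R) < m%:R by rewrite ltr0n.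
have mR' : (0 : R) < m'%:R by rewrite ltr0n.
have E n : (0 : R) < n%:R -> critical_p R n = 2^-1 + 2^-1 * n%:R^-1.
  by move=> n0; rewrite /critical_p; field; rewrite gt_eqF.
rewrite !E// => /addrI/(mulfI _)/invr_inj => /(_ _)/eqP.
by rewrite eqr_nat => H; apply/eqP/H; rewrite invr_neq0.
Qed.

Theorem theorem5p8 (R : realType) (d m m' : nat)
    (u : 'I_m -> 'rV[R]_d) (w : 'I_m' -> 'rV[R]_d) (p a : R)
    (i0 : 'I_m) (j0 : 'I_m')
    (dO : measure_display) (Omega : measurableType dO)
    (P : probability Omega R)
    (s t : nat -> Omega -> 'rV[R]_d) (U V : forall n : nat, Omega -> 'I_n.+1)
    (d_ge1 : (1 <= d)%N) (m_ge2 : (2 <= m)%N) (m'_ge2 : (2 <= m')%N)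
    (u_inj : injective u) (w_inj : injective w)
    (p_gt0 : 0 < p) (p_lt1 : p < 1)
    (aE : a = (m%:R * p - 1) / (m%:R - 1))
    (pc_gt0 : 0 < critical_p R m)
    (pc_eq : critical_p R m = critical_p R m')
    (pc_ltp : critical_p R m' < p)
    (s_step : step_process P u p i0 s U) :
  (range u <> range w ->
   is_lattice (semigroup_II u w) ->
   semigroup_II u w `&` set_translates (semigroup_II u w) (range u) = set0 ->
   step_process P w p j0 t V ->
   independent_processes P s U t V ->
   exists L : Omega -> 'rV[R]_d,
     [/\ random_vector L,
         ~ {ae P, forall x, L x = 0}
       & {ae P, forall x,
           skorokhod_cvg
             (fun n (r : R) => (n%:R `^ a)^-1 *:
                (walk_II s t (Num.truncn (2 * n%:R * r)) x
                 - (n%:R * r) *: (vmean u + vmean w)))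
             (fun r : R => (r `^ a) *: L x)}]) /\
  (range u = range w ->
   is_lattice (semigroup_I u) ->
   exists L : Omega -> 'rV[R]_d,
     [/\ random_vector L,
         ~ {ae P, forall x, L x = 0}
       & {ae P, forall x,
           skorokhod_cvg
             (fun n (r : R) => (n%:R `^ a)^-1 *:
                (walk_I s (Num.truncn (n%:R * r)) x
                 - (n%:R * r) *: vmean u))
             (fun r : R => (r `^ a) *: L x)}]).
Proof.
have m_m' : m = m' by apply: (critical_p_inj (R := R)) => //; exact: ltnW.
have [a_gt a_lt1] : 1 < 2 * a /\ a < 1.
  by apply: memory_exponent_bounds aE _ => //; rewrite pc_eq.
have a_gt0 : 0 < a by rewrite -(@pmulr_rgt0 _ 2) ?ltr0n// (lt_trans ltr01).
have aE' : a = (m'%:R * p - 1) / (m'%:R - 1) by rewrite -m_m'.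
have xi_chain := step_index_chain u_inj s_step.
set xi := step_index u i0 s in xi_chain.
have sE : forall n x, s n x = u (xi n x) := step_indexE s_step.
have mxi : forall n i, measurable (xi n @^-1` [set i]) by case: xi_chain.
have ae_xi := chain_deviation_cvg u m_ge2 p_gt0 p_lt1 aE a_gt a_lt1 xi_chain.
split=> [_ _ _ t_step indep|_ _].
  have eta_chain := step_index_chain w_inj t_step.
  set eta := step_index w j0 t in eta_chain.
  have tE : forall n x, t n x = w (eta n x) := step_indexE t_step.
  have meta : forall n i, measurable (eta n @^-1` [set i]) by case: eta_chain.
  have ae_eta := chain_deviation_cvg w m'_ge2 p_gt0 p_lt1 aE' a_gt a_lt1 eta_chain.
  pose g n x := deviation u (history xi n x) + deviation w (history eta n x).
  have [||L mL Lcv] := @random_vector_limit R d dO Omega P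
      (fun n x => (n%:R `^ a)^-1 *: g n x).
  - move=> n A; have -> : (fun x => (n%:R `^ a)^-1 *: g n x) @^-1` A =
        history (fun k x => (xi k x, eta k x)) n @^-1`
        [set T | A ((n%:R `^ a)^-1 *:
                    (deviation u (unzip1 T) + deviation w (unzip2 T)))].
      by apply/seteqP; split => x /=; rewrite unzip1_history unzip2_history.
    apply: measurable_history => k [i j].
    rewrite (_ : _ @^-1` _ = xi k @^-1` [set i] `&` eta k @^-1` [set j]).
      exact: measurableI.
    by apply/seteqP; split => x /= [-> ->].
  - apply: filterS2 ae_xi ae_eta => x cx ce.
    by under eq_fun do rewrite /g scalerDr; exact: is_cvgD.
  exists L; split=> // [L0|].
    apply: (pair_deviation_ncvg0 (w := w) m_ge2 m'_ge2 p_gt0 p_lt1 aE aE' a_gt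
              a_lt1 u_inj xi_chain eta_chain).
      move=> n n' A B; apply: indep; first exact: (history_process_sigma u_inj s_step).
      exact: (history_process_sigma w_inj t_step).
    by apply: filterS2 L0 Lcv => x -> .
  apply: filterS Lcv => x Lx.
  apply: (skorokhod_of_linear_correction (h := fun k => walk_II s t k x)
    (g := g ^~ x) (c := `|vmean u + vmean w| + \sum_i `|u i|)) => // y y0.
  (* the round in progress contributes at most one step of the first kind *)
  set k := Num.truncn y.
  have -> : walk_II s t (Num.truncn (2 * y)) x - y *: (vmean u + vmean w) - g k x =
      (k%:R *: (vmean u + vmean w) - y *: (vmean u + vmean w)) +
      (if odd (Num.truncn (2 * y)) then s k x else 0).
    rewrite /walk_II truncn_double// -/k big_split /=.
    rewrite /g -(walk_deviation _ _ sE) -(walk_deviation _ _ tE).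
    set S1 := \sum_(i < k) s i x; set S2 := \sum_(i < k) t i x.
    rewrite [in RHS]scalerDr; exact: regroup_differences.
  apply: le_trans (ler_normD _ _) _; rewrite lerD ?norm_truncn_sub_le//.
  case: ifP => _; last by rewrite normr0 sumr_ge0.
  by rewrite sE (bigD1 (xi k x))//= lerDl sumr_ge0.
pose g n x := deviation u (history xi n x).
have [|L mL Lcv] := @random_vector_limit R d dO Omega P
    (fun n x => (n%:R `^ a)^-1 *: g n x) _ ae_xi.
  move=> n A; exact: (measurable_history mxi n
    [set T | A ((n%:R `^ a)^-1 *: deviation u T)]).
exists L; split=> // [L0|].
  apply: (chain_deviation_ncvg0 m_ge2 p_gt0 p_lt1 aE a_gt a_lt1 u_inj xi_chain).
  by apply: filterS2 L0 Lcv => x -> .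
apply: filterS Lcv => x Lx.
rewrite (_ : (fun n r => _) = fun (n : nat) (r : R) => (n%:R `^ a)^-1 *:
    (walk_I s (Num.truncn (1 * n%:R * r)) x - (n%:R * r) *: vmean u)); last first.
  by apply/funext => n; apply/funext => r; rewrite mul1r.
apply: (skorokhod_of_linear_correction (h := fun k => walk_I s k x)
  (g := g ^~ x) (c := `|vmean u|)) => // y y0; rewrite mul1r.
set k := Num.truncn y.
rewrite /g -(walk_deviation _ _ sE) /walk_I.
set S := \sum_(i < k) _.
have -> : S - y *: vmean u - (S - k%:R *: vmean u) = k%:R *: vmean u - y *: vmean u.
  by rewrite opprB addrC subrKA.
exact: norm_truncn_sub_le.
Qed.
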